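(* Let $\mathcal{X},\mathcal{Y}$ be finite alphabets, $P_{Y|X}$ a channel from $\mathcal{X}$ to $\mathcal{Y}$, $m$ a fixed positive integer and $P_{\bar X}$ a fixed $m$-type on $\mathcal{X}$. For $n$ a multiple of $m$, let $R_{\breve X^n}$ be the uniform distribution on the type class $\mathcal{T}^n_{P_{\bar X}}$ and $R_{\breve Y^n}$ the output distribution obtained by passing $R_{\breve X^n}$ through the memoryless channel $P_{Y^n|X^n}$; assume non-degeneracy $P_{Y^n|X^n}\neq R_{\breve Y^n}$. For any $R>I(P_{\bar X},P_{Y|X})$ let $M=\lceil\exp(nR)\rceil$ and let $P_{\breve Y^n|\mathscr{D}_M^n}$ be the induced output distribution of the random constant-composition codebook $\mathscr{D}_M^n$. Then, with $n\to\infty$ along multiples of $m$, \[ \lim_{n\to\infty}-\frac1n\log\mathbb{E}\left[\left\|P_{\breve Y^n|\mathscr{D}_M^n}-R_{\breve Y^n}\right\|_1\right] =\min_{Q_{Y|X}\in\mathcal{P}(\mathcal{Y}|\mathcal{X})}\Big\{D(P_{\bar X}Q_{Y|X}\|P_{\bar X}P_{Y|X})+\tfrac12\big[R-D(P_{\bar X}Q_{Y|X}\|P_{\bar X}Q_Y)\big]_+\Big\} =\max_{\lambda\in[1,2]}\Big\{\frac{\lambda-1}{\lambda}\big(R-I^{\mathsf{c}}_\lambda(P_{\bar X},P_{Y|X})\big)\Big\}, \] where $Q_Y=\sum_xP_{\bar X}(x)Q_{Y|X}(\cdot|x)$ and $[f]_+=\max\{0,f\}$.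
   Context: Logarithms and exponentials are to an arbitrary but common base. An $m$-type is a distribution all of whose probabilities lie in $\{0,1/m,\dots,1\}$; the type class $\mathcal{T}^n_{P_{\bar X}}$ is the set of $x^n\in\mathcal{X}^n$ whose empirical distribution is $P_{\bar X}$. $P_{Y^n|X^n}(y^n|x^n)=\prod_iP_{Y|X}(y_i|x_i)$. The random constant-composition codebook $\mathscr{D}_M^n=\{\breve X_1^n,\dots,\breve X_M^n\}$ has codewords drawn independently and identically from $R_{\breve X^n}$, and $P_{\breve Y^n|\mathscr{D}_M^n}(y^n)=\frac1M\sum_{j=1}^MP_{Y^n|X^n}(y^n|\breve X_j^n)$. $\|P-Q\|_1=\sum|P-Q|$ (no factor $1/2$). $\mathcal{P}(\mathcal{Y}|\mathcal{X})$ is the set of all channels from $\mathcal{X}$ to $\mathcal{Y}$. $D$ is relative entropy, $I$ mutual information. Csiszár's $\alpha$-mutual information of order $\lambda$ is $I^{\mathsf{c}}_\lambda(P_X,P_{Y|X})=\min_{S_Y\in\mathcal{P}(\mathcal{Y})}\sum_xP_X(x)D_\lambda(P_{Y|X}(\cdot|x)\|S_Y)$, where $D_\lambda(P\|Q)=\frac{1}{\lambda-1}\log\sum_yP(y)^\lambda Q(y)^{1-\lambda}$ is the Rényi divergence ($D_1$ = relative entropy). *)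

(* Defs.v *)
From HB Require Import structures.
From mathcomp Require Import all_boot all_order all_algebra.
From mathcomp Require Import all_classical all_reals all_analysis.
Set Implicit Arguments. Unset Strict Implicit. Unset Printing Implicit Defensive.
Import Order.TTheory GRing.Theory Num.Theory.
Local Open Scope ring_scope.

Section Defs.
Variable R : realType.

Definition is_dist (T : finType) (p : T -> R) : Prop :=
  (forall t, 0 <= p t) /\ \sum_t p t = 1.

Definition is_channel (X Y : finType) (W : X -> Y -> R) : Prop :=
  forall x, is_dist (W x).

Definition is_mtype (X : finType) (m : nat) (P : X -> R) : Prop :=
  is_dist P /\ forall x, exists k : nat, P x = k%:R / m%:R.

Definition KL (T : finType) (p q : T -> R) : \bar R :=
  if [exists t, (0 < p t) && (q t == 0)] then +oo%E
  else (\sum_(t | 0 < p t) p t * ln (p t / q t))%:E.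

Definition joint (X Y : finType) (P : X -> R) (Q : X -> Y -> R) : X * Y -> R :=
  fun xy => P xy.1 * Q xy.1 xy.2.

Definition outdist (X Y : finType) (P : X -> R) (Q : X -> Y -> R) : Y -> R :=
  fun y => \sum_x P x * Q x y.

Definition prodd (X Y : finType) (P : X -> R) (S : Y -> R) : X * Y -> R :=
  fun xy => P xy.1 * S xy.2.

Definition mutinf (X Y : finType) (P : X -> R) (W : X -> Y -> R) : \bar R :=
  KL (joint P W) (prodd P (outdist P W)).

(* Renyi divergence of order l (used for l >= 1; D_1 = KL) *)
Definition renyi (T : finType) (l : R) (p q : T -> R) : \bar R :=
  if l == 1 then KL p q
  else if (1 < l) && [exists t, (0 < p t) && (q t == 0)] then +oo%E
  else ((l - 1)^-1 * ln (\sum_(t | 0 < p t) p t `^ l * q t `^ (1 - l)))%:E.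

Definition csiszar (X Y : finType) (l : R) (P : X -> R) (W : X -> Y -> R) : \bar R :=
  ereal_inf [set v : \bar R | exists S : Y -> R,
     is_dist S /\ v = (\sum_x (P x)%:E * renyi l (W x) S)%E].

Definition typeclass (X : finType) (n : nat) (P : X -> R) : {set n.-tuple X} :=
  [set x : n.-tuple X | [forall a, (count_mem a x)%:R / n%:R == P a]].

Definition chanN (X Y : finType) (n : nat) (W : X -> Y -> R)
  (x : n.-tuple X) (y : n.-tuple Y) : R :=
  \prod_(i < n) W (tnth x i) (tnth y i).

Definition outRY (X Y : finType) (n : nat) (P : X -> R) (W : X -> Y -> R)
  (y : n.-tuple Y) : R :=
  #|typeclass n P|%:R^-1 * \sum_(x in typeclass n P) chanN W x y.

Definition codeout (X Y : finType) (n M : nat) (W : X -> Y -> R)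
  (c : {ffun 'I_M -> n.-tuple X}) (y : n.-tuple Y) : R :=
  M%:R^-1 * \sum_(j < M) chanN W (c j) y.

(* E || P_{Y^n|D} - R_{Y^n} ||_1, codewords i.i.d. uniform on the type class *)
Definition expected_L1 (X Y : finType) (n M : nat) (P : X -> R) (W : X -> Y -> R) : R :=
  \sum_(c : {ffun 'I_M -> n.-tuple X} | [forall j, c j \in typeclass n P])
     (#|typeclass n P|%:R ^- M) *
     \sum_(y : n.-tuple Y) `|codeout W c y - outRY P W y|.

Definition ncode (Rt : R) (n : nat) : nat := `|Num.ceil (expR (n%:R * Rt))|%N.

Definition primal_obj (X Y : finType) (Rt : R) (P : X -> R) (W Q : X -> Y -> R) : \bar R :=
  (KL (joint P Q) (joint P W) +
   (2^-1)%:E * maxe 0 (Rt%:E - KL (joint P Q) (prodd P (outdist P Q))))%E.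

Definition dual_obj (X Y : finType) (Rt : R) (P : X -> R) (W : X -> Y -> R) (l : R) : \bar R :=
  (((l - 1) / l)%:E * (Rt%:E - csiszar l P W))%E.

End Defs.

(* Main.v *)
Require Import Defs.
From HB Require Import structures.
From mathcomp Require Import all_boot all_order all_algebra.
From mathcomp Require Import all_classical all_reals all_analysis.
From mathcomp Require Import ring lra.
Import Order.TTheory GRing.Theory Num.Theory numFieldNormedType.Exports.
Local Open Scope ring_scope.
Set Implicit Arguments.
Unset Strict Implicit.
Unset Printing Implicit Defensive.

(** For a fixed output word [y], the deviation of the codebook average splits
  over the joint types [N] of the codewords with [y]: it is the sum of the
  weights [w_N] times the centred binomial counts of the codewords of joint type
  [N], whose mean absolute deviation is of order [min (M p, sqrt (M p))].
  Counting type classes turns the triangle inequality into the exponential upper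
  bound.  Conversely, conditioning on whether each codeword has a given joint
  type with [y] can only decrease the expected absolute deviation and leaves a
  single centred binomial times [|w_N - r(y)|]; for [N] close to a minimiser of
  the primal, [r(y)] is negligible against [w_N] because the minimiser has
  positive mutual information, by non-degeneracy.

  Duality: [[x]_+ / 2] is the maximum of [r x] over [0 <= r <= 1/2], and the
  Lagrangian is convex in the channel, so a one-dimensional minimax argument
  yields an optimal [r = (l - 1) / l].  The output law of a primal minimiser is
  then the optimal [S_Y] in the definition of Csiszar's information of order
  [l]. *)

(** * The function t ln t *)

(** Mean and standard deviation both bound a binomial deviation; their minimum crosses over at
    [M p = 1], that is at I = R, and this produces the positive part and its factor 1/2. Bounding a
    mean absolute value from below needs more than a variance, hence the fourth moments. The counts
    of different joint types are dependent and could cancel each other in the signed sum. Averaging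
    out all types but one removes this obstacle at the price of comparing [w_N] with r(y). A crude
    estimate suffices there: since [R - I]_+ <= R, every competitor has divergence at least L - R/2,
    with L the primal minimum, so r(y) / w_N decays with exponent at least L - R/2 - D + I. At the
    minimiser this equals I/2 if I <= R and I - R/2 otherwise, positive in both cases. The
    optimisation runs over joint laws with first marginal P that vanish where the channel does.
    There all divergences are finite and extend continuously to the boundary; every other channel
    has an infinite objective. *)

Section EntropyFunction.
Local Open Scope classical_set_scope.
Variable R : realType.
Implicit Types x z s : R.

Definition xlnx x : R := x * ln x.

Lemma xlnx0 : xlnx 0 = 0.
Proof. by rewrite /xlnx mul0r. Qed.

(** This is the tangent of the convex function [xlnx] at [z]: the inequality [1 + t <= expR t] at
    [t = ln (z / x)], multiplied by [x]. *)
Lemma xlnx_tangent x z : 0 <= x -> 0 < z -> x * ln z + x - z <= xlnx x.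
Proof.
rewrite le_eqVlt => /predU1P[<-|x0] z0; first by rewrite xlnx0; lra.
have := expR_ge1Dx (ln z - ln x).
rewrite expRB !lnK ?posrE// => h.
rewrite /xlnx; have : x * (1 + (ln z - ln x)) <= x * (z / x) by rewrite ler_pM2l.
rewrite mulrCA divff ?gt_eqF// mulr1; lra.
Qed.

Lemma xlnx_tangent_eq x z : 0 <= x -> 0 < z ->
  xlnx x <= x * ln z + x - z -> x = z.
Proof.
rewrite le_eqVlt => /predU1P[<-|x0] z0; first by rewrite xlnx0; lra.
move=> h; apply/eqP/negPn/negP => xz.
have ne : ln z - ln x != 0.
  apply: contra xz; rewrite subr_eq0 => /eqP e.
  by apply/eqP; apply: ln_inj; rewrite ?posrE.
have := expR_gt1Dx ne; rewrite expRB !lnK ?posrE// => h1.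
have : x * (1 + (ln z - ln x)) < x * (z / x) by rewrite ltr_pM2l.
rewrite mulrCA divff ?gt_eqF// mulr1; move: h; rewrite /xlnx; lra.
Qed.

Lemma xlnx_convex s x z : 0 <= s <= 1 -> 0 <= x -> 0 <= z ->
  xlnx ((1 - s) * x + s * z) <= (1 - s) * xlnx x + s * xlnx z.
Proof.
move=> /andP[s0 s1] x0 z0; set w := _ + s * z.
have : 0 <= w by rewrite addr_ge0// mulr_ge0// subr_ge0.
rewrite le_eqVlt => /predU1P[w0|w0].
  have /andP[/eqP e1 /eqP e2] : ((1 - s) * x == 0) && (s * z == 0).
    by rewrite -paddr_eq0 -?/w -?w0// mulr_ge0// subr_ge0.
  by rewrite -w0 xlnx0 /xlnx !mulrA e1 e2 !mul0r addr0.
have h1 := xlnx_tangent x0 w0.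
have h2 := xlnx_tangent z0 w0.
have {h1}: (1 - s) * (x * ln w + x - w) <= (1 - s) * xlnx x.
  by rewrite ler_wpM2l// subr_ge0.
have {h2}: s * (z * ln w + z - w) <= s * xlnx z by rewrite ler_wpM2l.
have -> : xlnx w = (1 - s) * (x * ln w + x - w) + s * (z * ln w + z - w).
  by rewrite /xlnx /w; ring.
lra.
Qed.

(** Continuity holds on the whole line because [ln] is 0 on nonpositive arguments, so [xlnx]
    vanishes there and only the right limit at 0 needs an estimate. *)
Lemma xlnx_continuous : continuous xlnx.
Proof.
move=> x; have [x0|x0|->] := ltgtP x 0.
- have : xlnx 0 @[_ --> x] --> xlnx x.
    by rewrite xlnx0 /xlnx ln0 ?ltW// mulr0; exact: cvg_cst.
  apply: cvg_trans; apply: near_eq_cvg; near=> t.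
  have t0 : t < 0 by near: t; exact: lt_nbhsl.
  by rewrite xlnx0 /xlnx ln0 ?mulr0// ltW.
- by apply: cvgM; [exact: cvg_id|exact: continuous_ln].
- rewrite /continuous_at xlnx0; apply/cvgrPdist_le => e e0; near=> t.
  rewrite sub0r normrN.
  have [t0|t0] := leP t 0; first by rewrite /xlnx ln0// mulr0 normr0 ltW.
  have t1 : t < 1 by near: t; exact: lt_nbhsl.
  have te : t < (e / 2) ^+ 2.
    by near: t; apply: lt_nbhsl; rewrite exprn_gt0// divr_gt0.
  (* [t |ln t| = 2 t |ln (sqrt t)| <= 2 sqrt t] *)
  pose u := Num.sqrt t.
  have u0 : 0 < u by rewrite sqrtr_gt0.
  have tE : t = u * u by rewrite -expr2 sqr_sqrtr// ltW.
  have ue : u < e / 2.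
    by rewrite -(@ltr_pXn2r _ 2)// ?nnegrE ?divr_ge0 ?ltW// expr2 -tE.
  have := @xlnx_tangent 1 u ler01 u0; rewrite /xlnx ln1 mulr0 mul1r => lnu.
  have := @xlnx_tangent u 1 (ltW u0) ltr01; rewrite /xlnx ln1 mulr0 => lnu'.
  rewrite normrM gtr0_norm// ler0_norm ?ln_le0 ?ltW// tE lnM ?posrE//.
  have u1 : u < 1 by rewrite -(@ltr_pXn2r _ 2)// ?nnegrE ?ltW// expr2 -tE expr1n.
  suff : u * (- (u * ln u)) <= u * 1 by lra.
  rewrite ler_pM2l//; lra.
Unshelve. all: by end_near.
Qed.

Variable T : finType.
Implicit Types p q : T -> R.

(** Sum the tangent inequalities at [q t]; the leftover terms [p t - q t] have nonnegative total.
    Keeping the logarithm of [q] alone, without a quotient, lets one statement serve for products,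
    tilted laws and marginals. *)
Lemma gibbs p q : (forall t, 0 <= p t) -> (forall t, 0 <= q t) ->
  (forall t, q t = 0 -> p t = 0) -> \sum_t q t <= \sum_t p t ->
  \sum_t p t * ln (q t) <= \sum_t xlnx (p t).
Proof.
move=> p0 q0 pq qp.
suff : \sum_t (p t * ln (q t) + p t - q t) <= \sum_t xlnx (p t).
  by rewrite sumrB big_split/=; lra.
apply: ler_sum => t _; have := q0 t; rewrite le_eqVlt => /predU1P[e|].
  by rewrite -e pq// xlnx0; lra.
exact: xlnx_tangent.
Qed.

Lemma gibbs_eq p q : (forall t, 0 <= p t) -> (forall t, 0 <= q t) ->
  (forall t, q t = 0 -> p t = 0) -> \sum_t q t = \sum_t p t ->
  \sum_t xlnx (p t) <= \sum_t p t * ln (q t) -> p =1 q.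
Proof.
move=> p0 q0 pq qp h.
pose d t := xlnx (p t) - (p t * ln (q t) + p t - q t).
have d0 t : 0 <= d t.
  rewrite subr_ge0; have := q0 t; rewrite le_eqVlt => /predU1P[e|].
    by rewrite -e pq// xlnx0; lra.
  exact: xlnx_tangent.
have sd : \sum_t d t = 0.
  apply/le_anti; rewrite sumr_ge0// andbT.
  by rewrite /d sumrB sumrB big_split/= qp; lra.
move=> t; have /psumr_eq0P : forall t, true -> 0 <= d t by [].
move=> /(_ sd t isT)/eqP; rewrite subr_eq0 => /eqP dt.
have := q0 t; rewrite le_eqVlt => /predU1P[e|qt]; first by rewrite -e pq.
by apply: xlnx_tangent_eq => //; rewrite dt.
Qed.

End EntropyFunction.

(** * Deviations of i.i.d. sums *)

Section IidSums.
Variables (R : realType) (T : finType) (mu : T -> R).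
Hypotheses (mu0 : forall x, 0 <= mu x) (mu1 : \sum_x mu x = 1).
Implicit Types (Z : T -> R) (F : R -> R) (A : pred T).

(* [iidE Z M F a] is the expectation of [F (a + Z X_1 + ... + Z X_M)] for
   i.i.d. [X_j] of law [mu]. *)
Fixpoint iidE Z (M : nat) F (a : R) : R :=
  if M is M'.+1 then \sum_x mu x * iidE Z M' F (a + Z x) else F a.

Definition ffcons M (u : T * {ffun 'I_M -> T}) : {ffun 'I_M.+1 -> T} :=
  [ffun i => oapp u.2 u.1 (unlift ord0 i)].

Lemma ffcons0 M (u : T * {ffun 'I_M -> T}) : ffcons u ord0 = u.1.
Proof. by rewrite ffunE unlift_none. Qed.

Lemma ffcons_lift M (u : T * {ffun 'I_M -> T}) j : ffcons u (lift ord0 j) = u.2 j.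
Proof. by rewrite ffunE liftK. Qed.

Lemma ffcons_bij M : bijective (@ffcons M).
Proof.
exists (fun f : {ffun 'I_M.+1 -> T} => (f ord0, [ffun j => f (lift ord0 j)])).
  move=> [x c]; rewrite ffcons0; congr (_, _); apply/ffunP => j.
  by rewrite ffunE ffcons_lift.
move=> f; apply/ffunP => i; case: (unliftP ord0 i) => [j ->|->].
  by rewrite ffcons_lift ffunE.
by rewrite ffcons0.
Qed.

(** Bridge from sums over whole codebooks to the recursive expectation, splitting off the first
    codeword. The offset [a] makes the induction go through. *)
Lemma iidE_ffun Z M F a :
  \sum_(c : {ffun 'I_M -> T}) (\prod_j mu (c j)) * F (a + \sum_j Z (c j))
  = iidE Z M F a.
Proof.
elim: M a => [|M IH] a.
  rewrite (big_pred1 (ffun0 (card_ord 0) : {ffun 'I_0 -> T})).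
    by rewrite !big_ord0 mul1r addr0.
  by move=> c; apply/esym/eqP/ffunP; case.
rewrite (reindex (@ffcons M)) /=; last exact: onW_bij (ffcons_bij M).
rewrite -(pair_bigA _ (fun x c => (\prod_j mu (ffcons (x, c) j)) *
   F (a + \sum_j Z (ffcons (x, c) j)))) /=.
apply: eq_bigr => x _; rewrite -IH mulr_sumr; apply: eq_bigr => c _.
rewrite !big_ord_recl !ffcons0 /= -mulrA addrA; congr (_ * (_ * F (_ + _))).
  by apply: eq_bigr => j _; rewrite ffcons_lift.
by apply: eq_bigr => j _; rewrite ffcons_lift.
Qed.

Lemma iidE_le Z M F G a : (forall t, F t <= G t) -> iidE Z M F a <= iidE Z M G a.
Proof.
move=> FG; elim: M a => [|M IH] a //=.
by apply: ler_sum => x _; rewrite ler_wpM2l.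
Qed.

Lemma eq_iidE Z Z' M F a : Z =1 Z' -> iidE Z M F a = iidE Z' M F a.
Proof.
move=> ZZ'; elim: M a => [|M IH] a //=.
by apply: eq_bigr => x _; rewrite IH ZZ'.
Qed.

Lemma iidE_lin Z M F G (k l a : R) :
  iidE Z M (fun t => k * F t + l * G t) a = k * iidE Z M F a + l * iidE Z M G a.
Proof.
elim: M a => [|M IH] a //=.
rewrite !mulr_sumr -big_split; apply: eq_bigr => x _ /=.
by rewrite IH; ring.
Qed.

Lemma iidE_cst Z M (k a : R) : iidE Z M (fun=> k) a = k.
Proof.
elim: M a => [|M IH] a //=.
under eq_bigr do rewrite IH.
by rewrite -mulr_suml mu1 mul1r.
Qed.

Lemma iidE_norm_scale Z M (k a : R) :
  iidE (fun x => k * Z x) M Num.norm (k * a) = `|k| * iidE Z M Num.norm a.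
Proof.
elim: M a => [|M IH] a /=; first by rewrite normrM.
rewrite mulr_sumr; apply: eq_bigr => x _.
by rewrite -mulrDr IH mulrCA.
Qed.

Lemma iidE_norm_sum (I : finType) (Z : I -> T -> R) M (a : I -> R) :
  iidE (fun x => \sum_i Z i x) M Num.norm (\sum_i a i) <=
  \sum_i iidE (Z i) M Num.norm (a i).
Proof.
elim: M a => [|M IH] a /=; first exact: ler_norm_sum.
rewrite exchange_big /=; apply: ler_sum => x _.
by rewrite -mulr_sumr -big_split ler_wpM2l// IH.
Qed.

Lemma iidE_norm_le Z M (a : R) :
  iidE Z M Num.norm a <= `|a| + M%:R * \sum_x mu x * `|Z x|.
Proof.
elim: M a => [|M IH] a /=; first by rewrite mul0r addr0.
set K := \sum_x _ in IH *.
apply: (@le_trans _ _ (\sum_x mu x * ((`|a| + M%:R * K) + `|Z x|))).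
  apply: ler_sum => x _; rewrite ler_wpM2l//; apply: (le_trans (IH _)).
  by rewrite addrAC lerD2r ler_normD.
under eq_bigr do rewrite mulrDr.
by rewrite big_split/= -mulr_suml mu1 mul1r -/K -natr1; lra.
Qed.

(* Conditional Jensen: averaging the summand outside [A], where it is constant
   on [A], decreases the expected absolute value. *)
Lemma iidE_norm_cond Z Z' A M (a : R) :
  (forall x, A x -> Z' x = Z x) ->
  (exists g, forall x, ~~ A x -> Z' x = g) ->
  \sum_(x | ~~ A x) mu x * Z' x = \sum_(x | ~~ A x) mu x * Z x ->
  iidE Z' M Num.norm a <= iidE Z M Num.norm a.
Proof.
move=> ZA [g Zg] ZZ; elim: M a => [|M IH] a //=.
(* Hybrid argument: only the first summand changes here, the other [M] being [Z'] already. A second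
   induction swaps the order of summation until the changed summand comes last, where Jensen's
   inequality for the norm applies directly. *)
apply: (@le_trans _ _ (\sum_x mu x * iidE Z' M Num.norm (a + Z x))); last first.
  by apply: ler_sum => x _; rewrite ler_wpM2l.
elim: M a {IH} => [|M IH] a /=.
  rewrite (bigID A)/= [leRHS](bigID A)/=; apply: lerD.
    by rewrite le_eqVlt; apply/orP; left; apply/eqP; apply: eq_bigr => x /ZA ->.
  under eq_bigr => x /Zg e do rewrite e.
  rewrite -mulr_suml.
  have s0 : 0 <= \sum_(x | ~~ A x) mu x by apply: sumr_ge0.
  rewrite -{1}(ger0_norm s0) -normrM.
  have -> : (\sum_(x | ~~ A x) mu x) * (a + g) = \sum_(x | ~~ A x) mu x * (a + Z x).
    rewrite mulrDr; under [RHS]eq_bigr do rewrite mulrDr.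
    rewrite [RHS]big_split/= -mulr_suml -ZZ; congr (_ + _).
    by rewrite mulr_suml; apply: eq_bigr => x /Zg ->.
  apply: (le_trans (ler_norm_sum _ _ _)).
  by apply: ler_sum => x _; rewrite normrM ger0_norm.
rewrite [leRHS](_ : _ = \sum_y mu y * \sum_x mu x * iidE Z' M Num.norm (a + Z' y + Z x)).
  by apply: ler_sum => y _; rewrite ler_wpM2l.
under eq_bigr do rewrite mulr_sumr.
rewrite exchange_big/=; apply: eq_bigr => x _; rewrite mulr_sumr.
by apply: eq_bigr => y _; rewrite mulrCA addrAC.
Qed.

Section Moments.
Variable Z : T -> R.
Let mom k := \sum_x mu x * Z x ^+ k.
Hypothesis mom1 : mom 1 = 0.

Let mom_poly (c0 c1 c2 c3 c4 : R) :
  \sum_x mu x * (c0 + c1 * Z x + c2 * Z x ^+ 2 + c3 * Z x ^+ 3 + c4 * Z x ^+ 4) =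
  c0 + c2 * mom 2 + c3 * mom 3 + c4 * mom 4.
Proof.
have -> : c0 + c2 * mom 2 + c3 * mom 3 + c4 * mom 4 =
  c0 * (\sum_x mu x) + c1 * mom 1 + c2 * mom 2 + c3 * mom 3 + c4 * mom 4.
  by rewrite mu1 mom1; ring.
by rewrite /mom !mulr_sumr -!big_split; apply: eq_bigr => x _ /=; ring.
Qed.

Lemma iidE_sqr M a : iidE Z M (fun t => t ^+ 2) a = a ^+ 2 + M%:R * mom 2.
Proof.
elim: M a => [|M IH] a /=; first by rewrite mul0r addr0.
transitivity (a ^+ 2 + M%:R * mom 2 + 1 * mom 2 + 0 * mom 3 + 0 * mom 4).
  rewrite -(mom_poly _ (2 * a)); apply: eq_bigr => x _; rewrite IH; ring.
by rewrite -natr1; ring.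
Qed.

Lemma iidE_pow4 M a : iidE Z M (fun t => t ^+ 4) a =
  a ^+ 4 + 6 * a ^+ 2 * (M%:R * mom 2) + 4 * a * (M%:R * mom 3) +
  M%:R * mom 4 + 3 * M%:R * (M%:R - 1) * mom 2 ^+ 2.
Proof.
elim: M a => [|M IH] a /=; first by ring.
transitivity (
  (a ^+ 4 + 6 * a ^+ 2 * (M%:R * mom 2) + 4 * a * (M%:R * mom 3) +
   M%:R * mom 4 + 3 * M%:R * (M%:R - 1) * mom 2 ^+ 2) +
  (6 * a ^+ 2 + 6 * M%:R * mom 2) * mom 2 + (4 * a) * mom 3 + 1 * mom 4).
  rewrite -(mom_poly _ (4 * a ^+ 3 + 12 * a * (M%:R * mom 2) + 4 * (M%:R * mom 3))).
  by apply: eq_bigr => x _; rewrite IH; ring.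
by rewrite -natr1; ring.
Qed.

(* [u >= u^2 - u^4 / 4] for [u = |t| / s], with [s^2 = 1 + 3 sigma^2] *)
Lemma iidE_norm_ge M (s2 := M%:R * mom 2) : mom 4 <= mom 2 ->
  3 / 4 * s2 / Num.sqrt (1 + 3 * s2) <= iidE Z M Num.norm 0.
Proof.
move=> m42.
have m20 : 0 <= mom 2.
  by apply: sumr_ge0 => x _; rewrite mulr_ge0// sqr_ge0.
have s20 : 0 <= s2 by rewrite mulr_ge0.
set s := Num.sqrt _.
have s0 : 0 < s by rewrite sqrtr_gt0; lra.
have sE : s ^+ 2 = 1 + 3 * s2 by rewrite sqr_sqrtr//; lra.
apply: (@le_trans _ _ (iidE Z M (fun t => s^-1 * t ^+ 2 + (- (4 * s ^+ 3)^-1) * t ^+ 4)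
  0)).
  rewrite iidE_lin iidE_sqr iidE_pow4 -/s2 !expr0n /= !add0r mulr0 mul0r mulr0 mul0r
    !add0r.
  (* This fixes the choice of [s]: as [mom 4 <= mom 2], the fourth moment is at most
     [s2 + 3 * s2 ^+ 2 = s2 * s ^+ 2], and [s2 / s - s2 / (4 s)] leaves the factor 3/4. *)
  have : M%:R * mom 4 + 3 * M%:R * (M%:R - 1) * mom 2 ^+ 2 <= s2 * s ^+ 2.
    rewrite sE /s2.
    have : M%:R * mom 4 <= M%:R * mom 2 by rewrite ler_wpM2l.
    have : 0 <= M%:R * mom 2 ^+ 2 by rewrite mulr_ge0// sqr_ge0.
    nra.
  have : 0 < (4 * s ^+ 3)^-1 by rewrite invr_gt0 mulr_gt0// exprn_gt0.
  move=> k0 /(ler_wpM2l (ltW k0)).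
  rewrite (_ : _^-1 * (s2 * _) = s2 / s / 4); last by field; rewrite gt_eqF.
  by rewrite (mulrC s^-1); lra.
apply: iidE_le => t.
pose u := `|t| / s.
have u0 : 0 <= u by apply: divr_ge0 => //; exact: ltW.
have tE : `|t| = u * s by rewrite /u divfK ?gt_eqF.
have t2 : t ^+ 2 = (u * s) ^+ 2 by rewrite -tE real_normK// num_real.
have -> : s^-1 * t ^+ 2 + - (4 * s ^+ 3)^-1 * t ^+ 4 = s * (u * (u - u ^+ 3 / 4)).
  by rewrite (_ : 4 = 2 * 2)%N// exprM t2; field; rewrite gt_eqF.
rewrite tE mulrC ler_pM2r// ler_piMr//.
have : 0 <= (u - 1) ^+ 2 * (u + 2) by rewrite mulr_ge0 ?sqr_ge0//; lra.
by rewrite !exprS expr0; nra.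
Qed.

(** Cauchy-Schwarz in linearised form: [|t| <= t ^+ 2 / (2 s) + s / 2] for all [s > 0], optimal at
    the standard deviation. When the variance is 0, [s] tends to 0 instead. *)
Lemma iidE_norm_le_sqrt M : iidE Z M Num.norm 0 <= Num.sqrt (M%:R * mom 2).
Proof.
set s2 := M%:R * _; have s20 : 0 <= s2.
  by rewrite mulr_ge0// sumr_ge0// => x _; rewrite mulr_ge0// sqr_ge0.
have key (s : R) : 0 < s -> iidE Z M Num.norm 0 <= (2 * s)^-1 * s2 + s / 2.
  move=> s0; apply: (@le_trans _ _ (iidE Z M (fun t => (2 * s)^-1 * t ^+ 2 + s / 2 * 1)
    0)).
    apply: iidE_le => t; rewrite -(@real_normK _ t) ?num_real//.
    rewrite -subr_ge0 (_ : _ - _ = (2 * s)^-1 * (`|t| - s) ^+ 2).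
      by rewrite mulr_ge0 ?sqr_ge0// invr_ge0 mulr_ge0// ltW.
    by field; rewrite gt_eqF.
  by rewrite iidE_lin iidE_sqr iidE_cst expr0n/= add0r mulr1.
move: s20; rewrite le_eqVlt => /predU1P[e|s20].
  rewrite -e sqrtr0; apply/ler_addgt0Pl => e' e'0; rewrite addr0.
  by apply: (le_trans (key _ e'0)); rewrite -e mulr0 add0r; lra.
have s0 : 0 < Num.sqrt s2 by rewrite sqrtr_gt0.
apply: (le_trans (key _ s0)); rewrite -[X in _ * X + _](sqr_sqrtr (ltW s20)).
by rewrite le_eqVlt; apply/orP; left; apply/eqP; field; rewrite gt_eqF.
Qed.

End Moments.

Section Indicator.
Variables (A : pred T) (p : R).
Hypothesis pE : \sum_(x | A x) mu x = p.
Let Z x := (A x)%:R - p.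

Let p_ge0 : 0 <= p. Proof. by rewrite -pE sumr_ge0. Qed.
Let p_le1 : p <= 1.
Proof. by rewrite -pE -mu1 [leRHS](bigID A)/= lerDl sumr_ge0. Qed.
Let sum_notA : \sum_(x | ~~ A x) mu x = 1 - p.
Proof. by have := mu1; rewrite (bigID A)/= pE => <-; rewrite addrAC subrr add0r. Qed.

Lemma sum_indicator (g : R -> R) :
  \sum_x mu x * g (Z x) = p * g (1 - p) + (1 - p) * g (- p).
Proof.
rewrite (bigID A)/= -[X in _ + X * _]sum_notA -[X in X * _ + _]pE !mulr_suml;
  congr (_ + _); apply: eq_bigr => x.
  by move=> Ax; rewrite /Z Ax.
by move=> /negbTE Ax; rewrite /Z Ax sub0r.
Qed.

Lemma iidE_indicator_le M :
  iidE Z M Num.norm 0 <= Num.min (2 * (M%:R * p)) (Num.sqrt (M%:R * p)).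
Proof.
have [p0 p1] := (p_ge0, p_le1); have q0 : 0 <= 1 - p by lra.
have pp : p * (1 - p) <= p by rewrite ler_piMr//; lra.
rewrite le_min; apply/andP; split.
  apply: (le_trans (iidE_norm_le _ _ _)); rewrite normr0 add0r.
  rewrite (sum_indicator (fun t => `|t|)) normrN (ger0_norm p0) (ger0_norm q0).
  by rewrite [leRHS]mulrCA ler_wpM2l//; lra.
apply: (@le_trans _ _ (Num.sqrt (M%:R * \sum_x mu x * Z x ^+ 2))).
  by apply: iidE_norm_le_sqrt; rewrite (sum_indicator (fun t => t ^+ 1)); ring.
rewrite (sum_indicator (fun t => t ^+ 2)) ler_wsqrtr// ler_wpM2l//.
by apply: le_trans pp; rewrite le_eqVlt; apply/orP; left; apply/eqP; ring.
Qed.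

(** The constant is half of 3/4, because [Num.sqrt (1 + 3 * s2)] is at most 2 when [s2 <= 1] and at
    most [2 * Num.sqrt s2] otherwise. A centred indicator meets the condition of [iidE_norm_ge],
    since its fourth moment is [p (1 - p) (1 - 3 p (1 - p))]. *)
Lemma iidE_indicator_ge M (s2 := M%:R * (p * (1 - p))) :
  3 / 8 * Num.min s2 (Num.sqrt s2) <= iidE Z M Num.norm 0.
Proof.
have [p0 p1] := (p_ge0, p_le1).
have m2 : \sum_x mu x * Z x ^+ 2 = p * (1 - p).
  by rewrite (sum_indicator (fun t => t ^+ 2)); ring.
have v0 : 0 <= p * (1 - p) by rewrite mulr_ge0//; lra.
have s20 : 0 <= s2 by rewrite mulr_ge0.
have := @iidE_norm_ge Z _ M _; rewrite m2 -/s2 => /(_ _ _)h.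
apply: le_trans (h _ _); last 2 first.
- by rewrite (sum_indicator (fun t => t ^+ 1)); ring.
- rewrite (sum_indicator (fun t => t ^+ 4)).
  have -> : p * (1 - p) ^+ 4 + (1 - p) * (- p) ^+ 4 =
    p * (1 - p) * (1 - 3 * (p * (1 - p))) by ring.
  by rewrite ler_piMr//; lra.
set s := Num.sqrt (1 + 3 * s2).
have s0 : 0 < s by rewrite sqrtr_gt0; lra.
have [s21|s21] := leP s2 1.
  apply: (@le_trans _ _ (3 / 8 * s2)).
    by rewrite ler_wpM2l ?ge_min ?lexx//; lra.
  have s_2 : s <= 2.
    have -> : 2 = Num.sqrt (2 ^+ 2) :> R by rewrite sqrtr_sqr ger0_norm.
    by rewrite ler_wsqrtr//; lra.
  rewrite ler_pdivlMr// (_ : 3 / 4 * s2 = 3 / 8 * s2 * 2); last by field.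
  by rewrite ler_wpM2l//; lra.
apply: (@le_trans _ _ (3 / 8 * Num.sqrt s2)).
  by rewrite ler_wpM2l ?ge_min ?lexx ?orbT//; lra.
have s_2 : s <= 2 * Num.sqrt s2.
  have -> : 2 = Num.sqrt (2 ^+ 2) :> R by rewrite sqrtr_sqr ger0_norm.
  by rewrite -sqrtrM ?sqr_ge0// ler_wsqrtr//; lra.
rewrite ler_pdivlMr//.
rewrite -[in leRHS](@sqr_sqrtr _ s2)// (_ : 3 / 4 * _ =
   3 / 8 * Num.sqrt s2 * (2 * Num.sqrt s2)); last by field.
by rewrite ler_wpM2l// mulr_ge0//; lra.
Qed.

(** Averaging [f - r] off [A] leaves a two-valued centred variable, hence a multiple of the centred
    indicator of [A]. This isolates one joint type from all the others. *)
Lemma iidE_dev_ge (f : T -> R) (w : R) M (r := \sum_x mu x * f x) :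
  (forall x, A x -> f x = w) ->
  3 / 8 * `|w - r| * Num.min (M%:R * p) (Num.sqrt (M%:R * p)) <=
  iidE (fun x => f x - r) M Num.norm 0.
Proof.
move=> fw.
have [p0 p1] := (p_ge0, p_le1).
have rE : \sum_(x | ~~ A x) mu x * f x = r - p * w.
  have e : \sum_(x | A x) mu x * f x = p * w.
    by rewrite -pE mulr_suml; apply: eq_bigr => x /fw ->.
  by rewrite /r [in RHS](bigID A)/= e addrAC subrr add0r.
have dE : \sum_(x | ~~ A x) mu x * (f x - r) = - (p * (w - r)).
  under eq_bigr do rewrite mulrBr.
  by rewrite sumrB rE -mulr_suml sum_notA; ring.
move: p1; rewrite le_eqVlt => /predU1P[pe1|plt1].
  have mu_notA x : ~~ A x -> mu x = 0.
    have s0 : \sum_(i | ~~ A i) mu i = 0 by rewrite sum_notA pe1 subrr.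
    by move: x; apply: (psumr_eq0P _ s0).
  have : w - r = 0.
    apply/eqP; rewrite -oppr_eq0 -[w - r]mul1r -pe1 -dE big1// => x /mu_notA ->.
    by rewrite mul0r.
  move=> ->; rewrite normr0 mulr0 mul0r.
  have := @iidE_le (fun x => f x - r) M (fun=> 0) Num.norm 0 (@normr_ge0 _ _).
  by rewrite iidE_cst.
(* The average of [f - r] off [A] is [- p (w - r) / (1 - p) = k * (- p)], so [k * Z] is the averaged
   variable. The factor [1 / (1 - p)] in [k] later pays for the [1 - p] in the variance. *)
pose k := (w - r) / (1 - p).
have q0 : 0 < 1 - p by lra.
apply: le_trans (@iidE_norm_cond _ (fun x => k * Z x) A M 0 _ _ _); last 3 first.
- by move=> x Ax; rewrite /Z Ax fw// /k divfK ?gt_eqF.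
- by exists (k * - p) => x /negbTE Ax; rewrite /Z Ax sub0r.
- rewrite dE (eq_bigr (fun x => mu x * (k * - p))).
    rewrite -mulr_suml sum_notA /k; field; exact: lt0r_neq0.
  by move=> x /negbTE Ax; rewrite /Z Ax sub0r.
rewrite -(mulr0 k) iidE_norm_scale.
apply: le_trans (ler_wpM2l (normr_ge0 k) (iidE_indicator_ge M)).
have kE : `|k| = `|w - r| / (1 - p) by rewrite normrM normfV (gtr0_norm q0).
rewrite kE [leRHS](_ : _ = 3 / 8 * `|w - r| * (Num.min (M%:R * (p * (1 - p)))
  (Num.sqrt (M%:R * (p * (1 - p)))) / (1 - p))); last by ring.
rewrite ler_wpM2l ?mulr_ge0 ?divr_ge0//.
rewrite ler_pdivlMr// le_min; apply/andP; split.
  by rewrite mulrA ler_wpM2r ?(ltW q0)// ge_min lexx.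
apply: (@le_trans _ _ (Num.sqrt (M%:R * p) * (1 - p))).
  by rewrite ler_wpM2r ?(ltW q0)// ge_min lexx orbT.
rewrite [in leRHS]mulrA [leRHS]sqrtrM ?mulr_ge0// ler_wpM2l ?sqrtr_ge0//.
rewrite -[leLHS](ger0_norm (ltW q0)) -sqrtr_sqr ler_wsqrtr// expr2 ler_piMr ?(ltW
  q0)//; lra.
Qed.

End Indicator.
End IidSums.

(** * The primal functional and its minimisers *)

Lemma sum_pair (M : nmodType) (X Y : finType) (F : X * Y -> M) :
  \sum_t F t = \sum_a \sum_b F (a, b).
Proof. by rewrite pair_bigA/=; apply: eq_bigr => -[]. Qed.

Section Optimization.
Variables (R : realType) (X Y : finType).
Variables (P : X -> R) (W : X -> Y -> R) (Rt : R).
Implicit Types (V : X * Y -> R) (s : R).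

(* [V] stands for a joint law on [X * Y] with first marginal [P]; [nent], [nentX]
   and [nentY] are the negative entropies of [V] and of its marginals, so that on
   [admissible] laws [div_joint] is D(V || P W) and [minfo] is I(V). *)
Definition margY V b : R := \sum_a V (a, b).
Definition nent V : R := \sum_t xlnx (V t).
Definition nentY V : R := \sum_b xlnx (margY V b).
Definition nentX : R := \sum_a xlnx (P a).
Definition mean_lnW V : R := \sum_t V t * ln (W t.1 t.2).
Definition div_joint V : R := nent V - nentX - mean_lnW V.
Definition minfo V : R := nent V - nentX - nentY V.
Definition lagrangian (r : R) V : R := div_joint V + r * (Rt - minfo V).
Definition primal V : R := div_joint V + 2^-1 * Num.max 0 (Rt - minfo V).

Definition admissible V : Prop :=
  [/\ forall t, 0 <= V t, forall a, \sum_b V (a, b) = P a &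
      forall t, W t.1 t.2 = 0 -> V t = 0].

Definition segment s V V' : X * Y -> R := fun t => (1 - s) * V t + s * V' t.

Hypotheses (HW : is_channel W) (HPd : is_dist P).

Let P0 a : 0 <= P a. Proof. by case: HPd. Qed.
Let W0 a b : 0 <= W a b. Proof. by case: (HW a). Qed.
Let W1 a : \sum_b W a b = 1. Proof. by case: (HW a). Qed.

Lemma admissible_joint : admissible (joint P W).
Proof.
split=> [t|a|t]; rewrite /joint /=; first by rewrite mulr_ge0.
  by rewrite -mulr_sumr W1 mulr1.
by move=> ->; rewrite mulr0.
Qed.

Lemma admissible_le V t : admissible V -> V t <= P t.1.
Proof.
case: t => a b [V0 VP _]; rewrite -VP (bigD1 b)//= lerDl.
by rewrite sumr_ge0.
Qed.

Lemma admissible_segment s V V' : 0 <= s <= 1 -> admissible V -> admissible V' ->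
  admissible (segment s V V').
Proof.
move=> /andP[s0 s1] [V0 VP VW] [V'0 V'P V'W]; split => [t|a|t Wt]; rewrite /segment.
- by rewrite addr_ge0// mulr_ge0// subr_ge0.
- by rewrite big_split/= -!mulr_sumr VP V'P; ring.
- by rewrite VW// V'W// !mulr0 addr0.
Qed.

Lemma margY_ge0 V b : admissible V -> 0 <= margY V b.
Proof. by case=> V0 _ _; apply: sumr_ge0. Qed.

Lemma margY_eq0 V a b : admissible V -> margY V b = 0 -> V (a, b) = 0.
Proof.
case=> V0 _ _ h; have := psumr_eq0P (P := xpredT) _ h; apply => //.
Qed.

Lemma margY_segment s V V' b : margY (segment s V V') b = (1 - s) * margY V b + s *
  margY V' b.
Proof. by rewrite /margY big_split/= -!mulr_sumr. Qed.

Lemma sum_margY V : admissible V -> \sum_b margY V b = 1.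
Proof.
case=> _ VP _; rewrite /margY exchange_big/=.
by rewrite (eq_bigr P) //; case: HPd.
Qed.

Lemma sum_mul_fst V (g : X -> R) : admissible V -> \sum_t V t * g t.1 = \sum_a P a * g a.
Proof.
case=> _ VP _; rewrite sum_pair/=.
by apply: eq_bigr => a _; rewrite -mulr_suml VP.
Qed.

Lemma sum_mul_snd V (g : Y -> R) : \sum_t V t * g t.2 = \sum_b margY V b * g b.
Proof.
rewrite sum_pair/= exchange_big/=.
by apply: eq_bigr => a _; rewrite -mulr_suml.
Qed.

Lemma nent_convex s V V' : 0 <= s <= 1 -> admissible V -> admissible V' ->
  nent (segment s V V') <= (1 - s) * nent V + s * nent V'.
Proof.
move=> s01 [V0 _ _] [V'0 _ _]; rewrite /nent !mulr_sumr -big_split.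
by apply: ler_sum => t _; exact: xlnx_convex.
Qed.

Lemma nentY_convex s V V' : 0 <= s <= 1 -> admissible V -> admissible V' ->
  nentY (segment s V V') <= (1 - s) * nentY V + s * nentY V'.
Proof.
move=> s01 KV KV'; rewrite /nentY !mulr_sumr -big_split.
by apply: ler_sum => b _; rewrite margY_segment; apply: xlnx_convex => //;
  exact: margY_ge0.
Qed.

Lemma mean_lnW_segment s V V' : mean_lnW (segment s V V') = (1 - s) * mean_lnW V + s *
  mean_lnW V'.
Proof.
by rewrite /mean_lnW !mulr_sumr -big_split; apply: eq_bigr => t _ /=; rewrite /segment;
  ring.
Qed.

Lemma lagrangianE r V : lagrangian r V = (1 - r) * nent V + r * nentY V - mean_lnW V +
  (r * Rt - (1 - r) * nentX).
Proof. by rewrite /lagrangian /div_joint /minfo; ring. Qed.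

(** In [lagrangianE] the two negative entropies carry the weights [1 - r] and [r], both nonnegative,
    and the rest is affine in [V]. The concave term [- r * minfo] is thus absorbed by the
    divergence. *)
Lemma lagrangian_convex r s V V' : 0 <= r <= 1 -> 0 <= s <= 1 -> admissible V ->
  admissible V' ->
  lagrangian r (segment s V V') <= (1 - s) * lagrangian r V + s * lagrangian r V'.
Proof.
move=> /andP[r0 r1] s01 KV KV'; rewrite !lagrangianE mean_lnW_segment.
have : (1 - r) * nent (segment s V V') <= (1 - r) * ((1 - s) * nent V + s * nent V').
  by rewrite ler_wpM2l ?subr_ge0// nent_convex.
have : r * nentY (segment s V V') <= r * ((1 - s) * nentY V + s * nentY V').
  by rewrite ler_wpM2l ?subr_ge0// nentY_convex.
lra.
Qed.

Lemma lagrangian_le_primal r V : 0 <= r <= 2^-1 -> lagrangian r V <= primal V.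
Proof.
move=> /andP[r0 r1]; rewrite /lagrangian /primal lerD2l.
apply: (@le_trans _ _ (r * Num.max 0 (Rt - minfo V))).
  by rewrite ler_wpM2l// le_max lexx orbT.
by rewrite ler_wpM2r// le_max lexx.
Qed.

Lemma joint_ge0 t : 0 <= joint P W t.
Proof. by case: admissible_joint. Qed.

Lemma joint_eq0 V t : admissible V -> joint P W t = 0 -> V t = 0.
Proof.
move=> KV /eqP; rewrite mulf_eq0 => /orP[|] /eqP e; last by case: KV => _ _; apply.
by apply/le_anti; case: (KV) => -> _ _; rewrite andbT -e admissible_le.
Qed.

Lemma sum_joint V : admissible V -> \sum_t joint P W t = \sum_t V t.
Proof.
move=> KV; rewrite !sum_pair; apply: eq_bigr => a _; case: (KV) => _ -> _.
by case: admissible_joint => _ -> _.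
Qed.

Lemma sum_ln_joint V : admissible V -> \sum_t V t * ln (joint P W t) = nentX + mean_lnW V.
Proof.
move=> KV; have [V0 _ VW] := KV.
rewrite (eq_bigr (fun t => V t * ln (P t.1) + V t * ln (W t.1 t.2))).
  by rewrite big_split/= (sum_mul_fst (fun a => ln (P a)) KV).
move=> t _; rewrite -mulrDr; have := V0 t; rewrite le_eqVlt => /predU1P[<-|Vt].
  by rewrite !mul0r.
have Pt : 0 < P t.1 by apply: lt_le_trans (admissible_le t KV).
have Wt : 0 < W t.1 t.2.
  rewrite lt_neqAle W0 andbT eq_sym; apply/eqP => /VW e.
  by rewrite e ltxx in Vt.
by rewrite lnM ?posrE.
Qed.

Lemma div_joint_ge0 V : admissible V -> 0 <= div_joint V.
Proof.
move=> KV; have [V0 _ _] := KV.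
suff : nentX + mean_lnW V <= nent V by rewrite /div_joint; lra.
rewrite -sum_ln_joint//; apply: gibbs => // [t|t|]; [exact: joint_ge0|exact: joint_eq0|].
by rewrite (sum_joint KV).
Qed.

Lemma div_joint_joint : div_joint (joint P W) = 0.
Proof. by rewrite /div_joint -addrA -opprD -(sum_ln_joint admissible_joint) /nent /xlnx
  subrr. Qed.

Lemma prodd_margY_ge0 V t : admissible V -> 0 <= prodd P (margY V) t.
Proof. by move=> KV; rewrite mulr_ge0// margY_ge0. Qed.

Lemma prodd_margY_eq0 V t : admissible V -> prodd P (margY V) t = 0 -> V t = 0.
Proof.
move=> KV /eqP; rewrite mulf_eq0 => /orP[|] /eqP e.
  by apply/le_anti; case: (KV) => -> _ _; rewrite andbT -e admissible_le.
by case: t e => a b; exact: margY_eq0.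
Qed.

Lemma sum_prodd_margY V : admissible V -> \sum_t prodd P (margY V) t = \sum_t V t.
Proof.
move=> KV; rewrite !sum_pair; apply: eq_bigr => a _; case: (KV) => _ -> _.
by rewrite /prodd /= -mulr_sumr sum_margY// mulr1.
Qed.

Lemma sum_ln_prodd_margY V : admissible V -> \sum_t V t * ln (prodd P (margY V) t) =
  nentX + nentY V.
Proof.
move=> KV; have [V0 _ _] := KV.
rewrite (eq_bigr (fun t => V t * ln (P t.1) + V t * ln (margY V t.2))).
  by rewrite big_split/= (sum_mul_fst (fun a => ln (P a)) KV) (sum_mul_snd V (fun b =>
    ln (margY V b))).
move=> [a b] _; rewrite -mulrDr /prodd /=; have := V0 (a, b).
rewrite le_eqVlt => /predU1P[<-|Vt]; first by rewrite !mul0r.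
have Pt : 0 < P a by apply: lt_le_trans (admissible_le (a, b) KV).
have mt : 0 < margY V b by rewrite /margY (bigD1 a)//= ltr_wpDr// sumr_ge0.
by rewrite lnM ?posrE.
Qed.

Lemma minfo_ge0 V : admissible V -> 0 <= minfo V.
Proof.
move=> KV; have [V0 _ _] := KV.
suff : nentX + nentY V <= nent V by rewrite /minfo; lra.
rewrite -sum_ln_prodd_margY//; apply: gibbs => // [t|t|];
  [exact: prodd_margY_ge0|exact: prodd_margY_eq0|].
by rewrite sum_prodd_margY.
Qed.

(** Equality case of Gibbs' inequality. A channel that ignores its input on the support of [P] is
    exactly what non-degeneracy forbids. *)
Lemma minfo_joint_le0 : minfo (joint P W) <= 0 ->
  forall a b, 0 < P a -> W a b = margY (joint P W) b.
Proof.
have KJ := admissible_joint; have [V0 _ _] := KJ => I0.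
have eqV : joint P W =1 prodd P (margY (joint P W)).
  apply: gibbs_eq => // [t|t| |]; [exact: prodd_margY_ge0|exact: prodd_margY_eq0|exact:
    sum_prodd_margY|].
  by rewrite sum_ln_prodd_margY//; move: I0; rewrite /minfo /nent; lra.
by move=> a b Pa; have := eqV (a, b); rewrite /prodd /= => /(mulfI (lt0r_neq0 Pa)).
Qed.

(** Tests the primal with the true channel. As divergences are nonnegative, a law whose primal value
    is below [Rt / 2] has positive [minfo]; this is how positivity passes to the minimiser. *)
Lemma primal_joint_lt : 0 < Rt -> 0 < minfo (joint P W) -> primal (joint P W) < Rt / 2.
Proof.
move=> R0 I0; rewrite /primal div_joint_joint add0r mulrC ltr_pM2r ?invr_gt0//.
by rewrite gt_max R0/=; lra.
Qed.

(** * Existence of an optimal multiplier *)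

Section Helly.
Local Open Scope classical_set_scope.
Local Open Scope ring_scope.
Variable L : R.
Hypothesis FL : forall V, admissible V -> L <= primal V.

(** [f V] and [h V] are the values at both ends of the affine function [lagrangian r V - L] of [r]
    in [0, 1/2]. The larger of the two is [primal V - L], so they are never both negative. *)
Let f V := lagrangian 0 V - L.
Let h V := lagrangian 2^-1 V - L.

Let fh_ge0 V : admissible V -> f V < 0 -> 0 <= h V.
Proof.
move=> /FL; rewrite /f /h /lagrangian /primal mul0r addr0 => + fV.
by case: (leP 0 (Rt - minfo V)) => _; rewrite ?mulr0; lra.
Qed.

Let fh_cross V1 V2 : admissible V1 -> admissible V2 -> f V1 < 0 -> h V2 < 0 ->
  f V1 * h V2 <= f V2 * h V1.
Proof.
move=> K1 K2 f1 h2; rewrite leNgt; apply/negP => c.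
have h1 := fh_ge0 K1 f1.
have f2 : 0 <= f V2 by rewrite leNgt; apply/negP => /(fh_ge0 K2); lra.
pose d := (f V2 - h V2) + (h V1 - f V1).
have d0 : 0 < d by rewrite /d; lra.
(* The weights make the two slopes cancel: the mixture of the affine functions is constant in [r],
   equal to [(f V2 * h V1 - f V1 * h V2) / d < 0]. By convexity both end values of the mixed law are
   then negative, which is impossible. *)
pose s := (h V1 - f V1) / d.
have s01 : 0 <= s <= 1.
  by rewrite /s divr_ge0 ?(ltW d0)/= ?ler_pdivrMr// /d; lra.
have Km := admissible_segment s01 K1 K2.
have s1 : 1 - s = (f V2 - h V2) / d by rewrite /s /d; field; rewrite -/d gt_eqF.
have mixL r : 0 <= r <= 1 -> lagrangian r (segment s V1 V2) - L <=
    ((f V2 - h V2) * (lagrangian r V1 - L) + (h V1 - f V1) * (lagrangian r V2 - L)) / d.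
  move=> r01; have := lagrangian_convex r01 s01 K1 K2.
  have -> : ((f V2 - h V2) * (lagrangian r V1 - L) + (h V1 - f V1) * (lagrangian r V2 -
    L)) / d =
    (1 - s) * (lagrangian r V1 - L) + s * (lagrangian r V2 - L) by rewrite s1 /s; ring.
  by lra.
have m1 : f (segment s V1 V2) < 0.
  apply: (le_lt_trans (mixL 0 _)); first by rewrite lexx ler01.
  rewrite pmulr_llt0 ?invr_gt0// -/(f V1) -/(f V2); lra.
have m2 : h (segment s V1 V2) < 0.
  apply: (le_lt_trans (mixL 2^-1 _)); first by lra.
  rewrite pmulr_llt0 ?invr_gt0// -/(h V1) -/(h V2); lra.
by have := fh_ge0 Km m1; lra.
Qed.

(* Minimax in the one-dimensional parameter: each [V] excludes an interval of
   mixing weights, and by convexity no two of them cover [0, 1/2]. *)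
Lemma exists_weight : exists2 r, 0 <= r <= 2^-1 & forall V, admissible V -> L <=
  lagrangian r V.
Proof.
(* In the coordinate [s = 2 r], a law with [f V < 0] rules out all [s] below the zero of its affine
   function. [E] collects these zeros, and 0 makes it nonempty; [fh_cross] keeps its supremum below
   the zeros of the decreasing functions. *)
pose E : set R := [set s | s = 0 \/
  exists V, [/\ admissible V, f V < 0 & s = - f V / (h V - f V)]].
have gE t V : f V + t * (h V - f V) = lagrangian (t / 2) V - L.
  by rewrite /f /h /lagrangian; field.
have ubE1 : ubound E 1.
  move=> _ [->//|[V [KV fV ->]]]; have hV := fh_ge0 KV fV.
  by rewrite ler_pdivrMr; lra.
have hsE : has_sup E by split; [exists 0; left|exists 1].
have supE0 : 0 <= sup E by apply: (sup_ubound (proj2 hsE)); left.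
have supE1 : sup E <= 1 by apply: ge_sup => //; exists 0; left.
exists (sup E / 2); first by lra.
move=> V KV; rewrite -subr_ge0 -gE.
have [fV|fV] := ltP (f V) 0.
  have hV := fh_ge0 KV fV.
  have : - f V / (h V - f V) <= sup E.
    by apply: (sup_ubound (proj2 hsE)); right; exists V.
  by rewrite ler_pdivrMr; lra.
have [hV|hV] := ltP (h V) 0; last by nra.
have : sup E <= f V / (f V - h V).
  apply: ge_sup; first by exists 0; left.
  move=> _ [->|[V1 [K1 f1 ->]]]; first by apply: divr_ge0 => //; lra.
  have h1 := fh_ge0 K1 f1.
  rewrite ler_pdivrMr; last by lra.
  rewrite mulrAC ler_pdivlMr; last by lra.
  by have := fh_cross K1 KV f1 hV; lra.
by rewrite ler_pdivlMr; lra.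
Qed.

End Helly.
End Optimization.

(** * First-order conditions at a minimiser of the Lagrangian *)

Section DualPoint.
Variables (R : realType) (X Y : finType).
Variables (P : X -> R) (W : X -> Y -> R) (Rt : R).
Implicit Types (V : X * Y -> R) (s : R).
Hypotheses (HPd : is_dist P).
Variables (r : R) (V0 : X * Y -> R).
Hypotheses (r01 : 0 < r <= 2^-1) (KV0 : admissible P W V0).
Hypothesis V0min : forall V, admissible P W V -> lagrangian P W Rt r V0 <= lagrangian P
  W Rt r V.
Let S := margY V0.
Notation G := (lagrangian P W Rt r).
Notation K := (admissible P W).

(* [t ln t] has slope [-oo] at [0], so the minimiser charges every reachable
   output. *)
Lemma minimizer_support V b : K V -> margY V0 b = 0 -> margY V b = 0.
Proof.
move=> KV Sb; apply/eqP/negPn/negP => qn0.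
have q0 : 0 < margY V b by rewrite lt_neqAle eq_sym qn0 (margY_ge0 b KV).
set q := margY V b in q0 qn0 *.
have dG := V0min KV.
(* Moving by [t = expR (- c)] towards [V] costs at most [t * (G V - G V0)] and gains
   [t * r * q * c], from the term [t * q * ln t] at the empty output. This [c] makes the gain exceed
   the cost by [t]. *)
pose c := (G V - G V0 + 1) / (r * q).
have rq0 : 0 < r * q by rewrite mulr_gt0//; case/andP: r01.
have c0 : 0 < c by rewrite divr_gt0//; lra.
pose t := expR (- c).
have t0 : 0 < t := expR_gt0 _.
have t1 : t <= 1 by rewrite -expR0 ler_expR; lra.
have t01 : 0 <= t <= 1 by rewrite (ltW t0).
have Psi_t : nentY (segment t V0 V) <= (1 - t) * nentY V0 + t * nentY V + t * q * ln t.
  rewrite /nentY (bigD1 b)//= [X in _ <= _ * X + _ + _](bigD1 b)//=.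
  rewrite [X in _ <= _ + _ * X + _](bigD1 b)//= margY_segment -/q Sb xlnx0 !mulr0 !add0r.
  have -> : xlnx (t * q) = t * xlnx q + t * q * ln t.
    by rewrite /xlnx lnM ?posrE//; ring.
  have : \sum_(i | i != b) xlnx (margY (segment t V0 V) i) <=
    (1 - t) * \sum_(i | i != b) xlnx (margY V0 i) + t * \sum_(i | i != b) xlnx (margY V
      i).
    rewrite !mulr_sumr -big_split; apply: ler_sum => i _ /=.
    by rewrite margY_segment; apply: xlnx_convex => //;
      [exact: margY_ge0 KV0|exact: margY_ge0 KV].
  lra.
have Phi_t := nent_convex t01 KV0 KV.
have := V0min (admissible_segment t01 KV0 KV); rewrite !lagrangianE mean_lnW_segment in
  dG *.
case/andP: r01 => r0 r1.
have : (1 - r) * nent (segment t V0 V) <= (1 - r) * ((1 - t) * nent V0 + t * nent V).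
  by rewrite ler_wpM2l//; lra.
have : r * nentY (segment t V0 V) <= r * ((1 - t) * nentY V0 + t * nentY V + t * q * ln
  t).
  by rewrite ler_wpM2l// ltW.
have lnt : ln t = - c by rewrite /t expRK.
have : t * (r * q * c) = t * (G V - G V0 + 1).
  by congr (_ * _); rewrite /c mulrC divfK// gt_eqF.
rewrite !lagrangianE lnt; nra.
Qed.

(* The gap between [lagrangian] and the linearised functional is [r] times a relative
   entropy to [S], which is quadratic along segments issued from [V0]. *)
Lemma minimizer_dual V : K V ->
  G V0 <= div_joint P W V + r * (Rt - (nent V - nentX P - \sum_b margY V b * ln (S b))).
Proof.
move=> KV; have [r0 r1] := andP r01.
(* Chi-square distance of the output laws. By [ln u <= u - 1], the relative entropy to [S] of the
   output law at parameter [t] is at most [t ^+ 2 * C]. *)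
pose C := \sum_b (margY V b - S b) ^+ 2 / S b.
have C0 : 0 <= C.
  by apply: sumr_ge0 => b _; rewrite divr_ge0 ?sqr_ge0// (margY_ge0 b KV0).
set H := div_joint _ _ _ + _.
have key t : 0 < t <= 1 -> G V0 <= H + r * t * C.
  move=> /andP[t0 t1]; have t01 : 0 <= t <= 1 by rewrite (ltW t0).
  have := V0min (admissible_segment t01 KV0 KV); rewrite !lagrangianE mean_lnW_segment.
  have Phi_t := nent_convex t01 KV0 KV.
  have : (1 - r) * nent (segment t V0 V) <= (1 - r) * ((1 - t) * nent V0 + t * nent V).
    by rewrite ler_wpM2l//; lra.
  have : nentY (segment t V0 V) <=
      (1 - t) * nentY V0 + t * \sum_b margY V b * ln (S b) + t ^+ 2 * C.
    (* Both output laws have total mass 1, so this zero sum can be added to absorb the first-order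
       part of the estimate term by term. *)
    have sd : \sum_b t * (margY V b - S b) = 0.
      by rewrite -mulr_sumr sumrB (sum_margY HPd KV) (sum_margY HPd KV0) subrr mulr0.
    rewrite -[leRHS]addr0 -[X in _ <= _ + X]sd /nentY /C !mulr_sumr -!big_split;
      apply: ler_sum => b _ /=.
    rewrite margY_segment -/(S b) /xlnx; set z := _ + t * _.
    have : 0 <= S b := margY_ge0 b KV0.
    rewrite le_eqVlt => /predU1P[/esym Sb|Sb].
      rewrite /z (minimizer_support KV Sb) Sb !(mulr0, mul0r, addr0, subr0, invr0).
      by rewrite ?expr0n ?mulr0 ?mul0r ?addr0.
    have z0 : 0 <= z.
      by rewrite addr_ge0// mulr_ge0// ?subr_ge0 ?(ltW t0) ?(ltW Sb)// (margY_ge0 b KV).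
    have zE : z = S b + t * (margY V b - S b) by rewrite /z; ring.
    have : z * ln z <= z * ln (S b) + z * (z / S b - 1).
      move: z0; rewrite le_eqVlt => /predU1P[<-|z0]; first by rewrite !mul0r addr0.
      rewrite -mulrDr ler_pM2l//.
      have := @xlnx_tangent _ 1 (z / S b) ler01 (divr_gt0 z0 Sb).
      by rewrite /xlnx ln1 mulr0 ln_div ?posrE//; lra.
    have -> : z * (z / S b - 1) =
        t * (margY V b - S b) + t ^+ 2 * ((margY V b - S b) ^+ 2 / S b).
      by rewrite zE; field; rewrite gt_eqF.
    have -> : z * ln (S b) = (1 - t) * (S b * ln (S b)) + t * (margY V b * ln (S b)).
      by rewrite /z; ring.
    lra.
  move=> /(ler_wpM2l (ltW r0)) hPsi hPhi hG.
  have HE : H = (1 - r) * nent V + r * (\sum_b margY V b * ln (S b)) - mean_lnW W V +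
                 (r * Rt - (1 - r) * nentX P) by rewrite /H /div_joint; ring.
  have : t * G V0 <= t * (H + r * t * C).
    by rewrite HE lagrangianE; nra.
  by rewrite ler_pM2l// lagrangianE.
apply/ler_addgt0Pl => e e0.
have rC : 0 < r * C + 1 by rewrite ltr_wpDl// mulr_ge0// ltW.
pose t := Num.min 1 (e / (r * C + 1)).
have t01 : 0 < t <= 1.
  by rewrite lt_min ltr01 divr_gt0//= ge_min lexx.
apply: (le_trans (key _ t01)); rewrite addrC lerD2r.
have te : t <= e / (r * C + 1) by rewrite ge_min lexx orbT.
apply: (@le_trans _ _ (t * (r * C + 1))); first by have := andP t01; nra.
by rewrite -ler_pdivlMr.
Qed.

End DualPoint.

(** * Continuity of the functionals and existence of a primal minimiser *)

Section Continuity.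
Local Open Scope classical_set_scope.
Variables (R : realType) (X Y : finType).
Variables (P : X -> R) (W : X -> Y -> R) (Rt : R).
Implicit Types (V : X * Y -> R).

Lemma cvg_sumr (T : Type) (I : finType) (Fi : set_system T) (f : I -> T -> R) (l : I ->
  R) :
  Filter Fi -> (forall i, f i x @[x --> Fi] --> l i) ->
  \sum_i f i x @[x --> Fi] --> \sum_i l i.
Proof. by move=> FF fl; apply: cvg_big => //; exact: add_continuous. Qed.

Section Cvg.
Variables (T : Type) (Fi : set_system T) (FF : Filter Fi).
Variables (U : T -> X * Y -> R) (V : X * Y -> R).
Hypothesis UV : forall t, U i t @[i --> Fi] --> V t.

Lemma margY_cvg b : margY (U i) b @[i --> Fi] --> margY V b.
Proof. by apply: cvg_sumr => a; exact: UV. Qed.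

Lemma nent_cvg : nent (U i) @[i --> Fi] --> nent V.
Proof.
apply: cvg_sumr => t; apply: (@cvg_comp _ _ _ (U^~ t) (@xlnx R) Fi (nbhs (V t))).
  exact: UV.
exact: xlnx_continuous.
Qed.

Lemma nentY_cvg : nentY (U i) @[i --> Fi] --> nentY V.
Proof.
apply: cvg_sumr => b.
apply: (@cvg_comp _ _ _ (fun i => margY (U i) b) (@xlnx R) Fi (nbhs (margY V b))).
  exact: margY_cvg.
exact: xlnx_continuous.
Qed.

Lemma div_joint_cvg : div_joint P W (U i) @[i --> Fi] --> div_joint P W V.
Proof.
apply: cvgB; first by apply: cvgB; [exact: nent_cvg|exact: cvg_cst].
by apply: cvg_sumr => t; apply: cvgM; [exact: UV|exact: cvg_cst].
Qed.

Lemma minfo_cvg : minfo P (U i) @[i --> Fi] --> minfo P V.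
Proof.
apply: cvgB; last exact: nentY_cvg.
by apply: cvgB; [exact: nent_cvg|exact: cvg_cst].
Qed.

Lemma primal_cvg : primal P W Rt (U i) @[i --> Fi] --> primal P W Rt V.
Proof.
apply: cvgD; first exact: div_joint_cvg.
apply: cvgM; first exact: cvg_cst.
have maxE (x : R) : Num.max 0 x = (x + `|x|) / 2.
  by case: (leP 0 x) => ?; [rewrite ger0_norm//|rewrite ltr0_norm//]; field.
have IR : Rt - minfo P (U i) @[i --> Fi] --> Rt - minfo P V.
  by apply: cvgB; [exact: cvg_cst|exact: minfo_cvg].
rewrite maxE; under eq_fun do rewrite maxE.
by apply: cvgM; [apply: cvgD => //; exact: cvg_norm|exact: cvg_cst].
Qed.

End Cvg.

Let fspace : topologicalType := prod_topology (fun _ : X * Y => R : topologicalType).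

Lemma admissible_compact : is_dist P -> compact (admissible P W : set fspace).
Proof.
move=> [P0 P1].
have evc t : continuous (fun V : fspace => V t : R).
  by move=> V; exact: (@proj_continuous _ (fun=> R : topologicalType) t V).
have sumc a : continuous (fun V : fspace => \sum_b V (a, b) : R).
  move=> V; apply: (@cvg_sumr fspace Y (nbhs V) (fun b (U : fspace) => U (a, b))
    (fun b => V (a, b))) => b.
  exact: (evc (a, b) V).
apply: (@subclosed_compact fspace _
  [set V : fspace | forall t, `[0, 1]%classic (V t : R)]).
- rewrite [X in closed X](_ : _ =
    (\bigcap_t (fun V : fspace => V t : R) @^-1` [set x | 0 <= x]) `&`
    ((\bigcap_a (fun V : fspace => \sum_b V (a, b) : R) @^-1` [set P a]) `&`
     \bigcap_(t in [set t | W t.1 t.2 = 0]) (fun V : fspace => V t : R) @^-1` [set 0])).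
    apply: closedI; [|apply: closedI].
    + apply: closed_bigI => t _; apply: preimage_closed; last exact: closed_ge.
      by move=> V _; exact: evc.
    + apply: closed_bigI => a _; apply: preimage_closed; last exact: closed_eq.
      by move=> V _; exact: sumc.
    + apply: closed_bigI => t _; apply: preimage_closed; last exact: closed_eq.
      by move=> V _; exact: evc.
  apply/seteqP; split=> [V [V0 VP VW]|V [V0 [VP VW]]].
    by split=> [t _|]; [exact: V0|split=> [a _|t Wt]; [exact: VP|exact: VW]].
  by split=> [t|a|t Wt]; [exact: V0|exact: VP|exact: VW].
- exact: (@tychonoff (X * Y)%type (fun=> R : topologicalType) (fun=> `[0, 1]%classic)
    (fun=> @segment_compact R 0 1)).
- move=> V KV t /=; rewrite in_itv/=; have [V0 _ _] := KV; rewrite V0/=.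
  apply: (le_trans (admissible_le t KV)); rewrite -P1 (bigD1 t.1)//= lerDl.
  exact: sumr_ge0.
Qed.

Lemma primal_min_exists : is_channel W -> is_dist P ->
  exists2 V, admissible P W V & forall V', admissible P W V' -> primal P W Rt V <=
    primal P W Rt V'.
Proof.
move=> HW HPd.
have [||V /set_mem KV Vmin] := compact_EVT_min _ (admissible_compact HPd) (f := primal
  P W Rt : fspace -> R).
- by exists (joint P W); exact: admissible_joint.
- apply: continuous_subspaceT => V.
  apply: (@primal_cvg fspace (nbhs V) _ (fun U => U) V) => t.
  exact: (@proj_continuous _ (fun=> R : topologicalType) t V).
- by exists V => // V' KV'; apply: Vmin; exact: mem_set.
Qed.

End Continuity.

(** * Counting type classes *)

Section Types.
Variables (R : realType) (A : finType).
Implicit Types (n : nat) (N : A -> nat).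

Definition cnt n (s : n.-tuple A) (a : A) : nat := \sum_(i < n) (tnth s i == a).

Definition emp n (s : n.-tuple A) (a : A) : R := (cnt s a)%:R / n%:R.

Lemma cnt_mem n (s : n.-tuple A) a : count_mem a s = cnt s a.
Proof.
by rewrite -sum1_count big_tuple big_mkcond; apply: eq_bigr => i _ /=; case: eqP.
Qed.

Lemma sum_tnth_cnt n (s : n.-tuple A) (g : A -> R) :
  \sum_i g (tnth s i) = \sum_a (cnt s a)%:R * g a.
Proof.
under [RHS]eq_bigr do rewrite natr_sum mulr_suml.
rewrite exchange_big /=; apply: eq_bigr => i _.
rewrite (bigD1 (tnth s i))//= eqxx mul1r big1 ?addr0// => a /negbTE.
by rewrite eq_sym => ->; rewrite mul0r.
Qed.

Lemma sum_cnt n (s : n.-tuple A) : (\sum_a cnt s a)%N = n.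
Proof.
rewrite /cnt exchange_big /= -[RHS]card_ord -sum1_card; apply: eq_bigr => i _.
by rewrite (bigD1 (tnth s i))//= eqxx big1 ?addn0// => a /negbTE; rewrite eq_sym => ->.
Qed.

Lemma cnt_gt0 n (s : n.-tuple A) i : (0 < cnt s (tnth s i))%N.
Proof. by rewrite /cnt (bigD1 i)//= eqxx. Qed.

Lemma emp_gt0 n (s : n.-tuple A) i : 0 < emp s (tnth s i).
Proof.
by rewrite divr_gt0// ltr0n ?cnt_gt0//; case: (n) i => [[]|].
Qed.

Lemma prod_emp n (s : n.-tuple A) (f : A -> R) : (0 < n)%N ->
  (forall i, 0 < f (tnth s i)) ->
  \prod_i f (tnth s i) = expR (n%:R * \sum_a emp s a * ln (f a)).
Proof.
move=> n0 f0.
rewrite (_ : n%:R * _ = \sum_i ln (f (tnth s i))).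
  by rewrite expR_sum; apply: eq_bigr => i _; rewrite lnK// posrE.
rewrite (sum_tnth_cnt s (fun a => ln (f a))) mulr_sumr; apply: eq_bigr => a _.
by rewrite mulrA /emp mulrCA divff ?mulr1// pnatr_eq0 -lt0n.
Qed.

Lemma sum_tuple_prod n (F : 'I_n -> A -> R) :
  \sum_(s : n.-tuple A) \prod_i F i (tnth s i) = \prod_i \sum_a F i a.
Proof.
rewrite bigA_distr_bigA/=.
rewrite (reindex (fun f : {ffun 'I_n -> A} => [tuple f i | i < n])) /=.
  by apply: eq_bigr => f _; apply: eq_bigr => i _; rewrite tnth_mktuple.
exists (fun s : n.-tuple A => [ffun i => tnth s i]) => s _.
  by apply/ffunP => i; rewrite ffunE tnth_mktuple.
by apply: eq_from_tnth => i; rewrite tnth_mktuple ffunE.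
Qed.

(** A product measure of total mass at most 1 cannot give mass [k] to more than [1 / k] words. The
    factors may depend on the position, which is needed for conditional laws given an output
    word. *)
Lemma card_le_prod n (S : {set n.-tuple A}) (F : 'I_n -> A -> R) (k : R) :
  (forall i a, 0 <= F i a) -> (forall i, \sum_a F i a <= 1) ->
  (forall s, s \in S -> k <= \prod_i F i (tnth s i)) -> #|S|%:R * k <= 1.
Proof.
move=> F0 F1 kS; apply: (@le_trans _ _ (\sum_(s in S) \prod_i F i (tnth s i))).
  by rewrite mulr_natl -sumr_const; apply: ler_sum => s; exact: kS.
apply: (@le_trans _ _ (\sum_(s : n.-tuple A) \prod_i F i (tnth s i))).
  rewrite [leRHS](bigID (mem S))/= lerDl sumr_ge0// => s _.
  by apply: prodr_ge0 => i _.
rewrite sum_tuple_prod; apply: prodr_ile1 => i _.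
by rewrite F1 sumr_ge0.
Qed.

Definition tclass n N : {set n.-tuple A} :=
  [set s : n.-tuple A | [forall a, cnt s a == N a]].

Lemma tclassP n N (s : n.-tuple A) : reflect (forall a, cnt s a = N a) (s \in tclass n N).
Proof. by rewrite inE; apply: (iffP forallP) => h a; apply/eqP. Qed.

Lemma cnt_cons n a (s : n.-tuple A) b : cnt (cons_tuple a s) b = ((a == b) + cnt s b)%N.
Proof.
rewrite /cnt big_ord_recl; congr (_ + _)%N.
by apply: eq_bigr => i _; rewrite tnthS.
Qed.

Lemma sum_tuple_cons (M : nmodType) n (F : n.+1.-tuple A -> M) :
  \sum_s F s = \sum_a \sum_(s : n.-tuple A) F (cons_tuple a s).
Proof.
rewrite pair_bigA/= (reindex (fun u : A * n.-tuple A => cons_tuple u.1 u.2))//=.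
exists (fun s => (thead s, behead_tuple s)) => [[a s] _|s _].
  by congr (_, _); apply: val_inj.
by rewrite /= [RHS]tuple_eta; apply: val_inj.
Qed.

Lemma tclass_cons n N a (s : n.-tuple A) :
  (cons_tuple a s \in tclass n.+1 N) =
  (0 < N a)%N && (s \in tclass n (fun b => N b - (a == b))%N).
Proof.
apply/tclassP/andP => [h|[Na /tclassP h] b].
  split; first by rewrite -h cnt_cons eqxx.
  by apply/tclassP => b; rewrite -h cnt_cons addKn.
rewrite cnt_cons h; case: eqP => [<-|_]; last by rewrite subn0.
by rewrite subnKC.
Qed.

(** Multinomial coefficient, by induction on the length: the words starting with [a] contribute
    [N a * n!], and the [N a] add up to [n.+1]. *)
Lemma card_tclass n N : (\sum_a N a = n)%N ->
  (#|tclass n N| * \prod_a (N a)`! = n`!)%N.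
Proof.
elim: n N => [|n IH] N sN.
  have N0 a : N a = 0%N.
    by apply/eqP; move: sN => /eqP; rewrite sum_nat_eq0 => /forallP/(_ a).
  rewrite big1 ?muln1 => [|a _]; last by rewrite N0.
  rewrite (_ : tclass 0 N = [set [tuple]]) ?cards1//.
  apply/setP => s; rewrite [s]tuple0 !inE eqxx.
  by apply/forallP => a; rewrite N0 /cnt big_ord0.
rewrite -sum1_card big_mkcond/= (@sum_tuple_cons nat) big_distrl/=.
transitivity (\sum_a N a * n`!)%N; last by rewrite -big_distrl/= sN factS.
apply: eq_bigr => a _.
under eq_bigr do rewrite tclass_cons.
case: posnP => [->|Na] /=; first by rewrite big1.
rewrite -big_mkcond/= sum1_card -(IH (fun b => N b - (a == b))%N).
  rewrite mulnCA; congr (_ * _)%N.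
  rewrite (bigD1 a)//= [in RHS](bigD1 a)//= mulnA; congr (_ * _)%N.
    by rewrite eqxx subn1; case: (N a) Na => // k _; rewrite factS.
  by apply: eq_bigr => b; rewrite eq_sym => /negbTE ->; rewrite subn0.
move: sN; rewrite (bigD1 a)//= [X in _ -> X = _](bigD1 a)//= eqxx.
have -> : (\sum_(i | i != a) (N i - (a == i)) = \sum_(i | i != a) N i)%N.
  by apply: eq_bigr => b; rewrite eq_sym => /negbTE ->; rewrite subn0.
by case: (N a) Na => // k _; rewrite subn1 addSn => -[].
Qed.

End Types.

(** * Elementary Stirling bounds and sizes of type classes *)

Section Factorial.
Variable R : realType.

(** Rearranged, [1 / (n + 1) <= ln (1 + 1 / n) <= 1 / n], obtained from the tangents of [xlnx] at
    [n] and at [n + 1]. *)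
Lemma factS_step n : (0 < n)%N ->
  n%:R * (ln n.+1%:R - ln n%:R) <= 1 :> R /\
  1 - (ln n.+1%:R - ln n%:R) <= n%:R * (ln n.+1%:R - ln n%:R) :> R.
Proof.
move=> n0; have n0R : 0 < n%:R :> R by rewrite ltr0n.
have n1R : 0 < n.+1%:R :> R by rewrite ltr0n.
have := @xlnx_tangent R n%:R n.+1%:R (ltW n0R) n1R.
have := @xlnx_tangent R n.+1%:R n%:R (ltW n1R) n0R.
rewrite /xlnx -natr1; split; lra.
Qed.

Lemma fact_ge n : expR (xlnx n%:R - n%:R) <= n`!%:R :> R.
Proof.
elim: n => [|n IH]; first by rewrite xlnx0 subr0 expR0.
rewrite factS natrM -[X in X * _]lnK ?posrE ?ltr0n//.
apply: (le_trans _ (ler_wpM2l (expR_ge0 _) IH)); rewrite -expRD ler_expR.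
case: n IH => [|n] _; first by rewrite xlnx0 /xlnx ln1; lra.
have [+ _] := @factS_step n.+1 isT.
by rewrite /xlnx -(natr1 n.+1); lra.
Qed.

(** For positive [n] the induction yields the factor [expR 1 * n]; writing [n.+1] also covers
    [n = 0]. *)
Lemma fact_le n : n`!%:R <= expR 1 * n.+1%:R * expR (xlnx n%:R - n%:R) :> R.
Proof.
have e1 : 1 <= expR 1 :> R by rewrite -expR0 ler_expR.
case: n => [|n]; first by rewrite xlnx0 subr0 expR0 !mulr1.
apply: (@le_trans _ _ (expR 1 * n.+1%:R * expR (xlnx n.+1%:R - n.+1%:R))); last first.
  by rewrite ler_pM2r ?expR_gt0// ler_pM2l ?expR_gt0// ler_nat.
elim: n => [|n IH].
  by rewrite /xlnx ln1 mulr0 mulr1 add0r -expRD subrr expR0.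
rewrite factS natrM [X in _ <= X * _]mulrC -mulrA ler_pM2l ?ltr0n//.
apply: (le_trans IH); rewrite -[X in _ * X * _]lnK ?posrE ?ltr0n// -!expRD ler_expR.
have [_] := @factS_step n.+1 isT.
by rewrite /xlnx -(natr1 n.+1); lra.
Qed.

End Factorial.

Section TypeSize.
Variables (R : realType) (A : finType).

Lemma xlnx_div n (k : R) : (0 < n)%N -> 0 <= k ->
  n%:R * xlnx (k / n%:R) = xlnx k - k * ln n%:R.
Proof.
move=> n0; have n0R : 0 < n%:R :> R by rewrite ltr0n.
rewrite le_eqVlt => /predU1P[<-|k0]; first by rewrite !(mul0r, xlnx0) mulr0 subr0.
by rewrite /xlnx ln_div ?posrE//; field; rewrite gt_eqF.
Qed.

(** Stirling applied to the multinomial coefficient, each letter costing one factor [B]. The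
    opposite bound below needs no Stirling: the word law given by the type itself yields it without
    polynomial loss. *)
Lemma tclass_ge n (N : A -> nat) : (0 < n)%N -> (\sum_a N a = n)%N ->
  expR (- (n%:R * \sum_a xlnx ((N a)%:R / n%:R))) <=
  #|tclass n N|%:R * (expR 1 * n.+1%:R) ^+ #|A| :> R.
Proof.
move=> n0 sN; set B := expR 1 * _.
have sNR : \sum_a (N a)%:R = n%:R :> R by rewrite -natr_sum sN.
have Nle a : (N a <= n)%N by rewrite -sN (bigD1 a)//= leq_addr.
have B0 : 0 < B by rewrite mulr_gt0 ?expR_gt0 ?ltr0n.
have hfact : \prod_a ((N a)`!%:R : R) <=
    B ^+ #|A| * expR (\sum_a xlnx (N a)%:R - n%:R).
  rewrite -sNR -sumrB expR_sum -prodr_const -big_split/=.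
  apply: ler_prod => a _; rewrite ler0n/=; apply: (le_trans (fact_le R _)).
  by rewrite ler_pM2r ?expR_gt0// ler_pM2l ?expR_gt0// ler_nat ltnS.
have : expR (xlnx n%:R - n%:R) <= #|tclass n N|%:R *
    (B ^+ #|A| * expR (\sum_a xlnx (N a)%:R - n%:R)).
  apply: (le_trans (fact_ge R n)); rewrite -(card_tclass sN) natrM natr_prod.
  by rewrite ler_wpM2l.
have -> : - (n%:R * \sum_a xlnx ((N a)%:R / n%:R)) =
    (xlnx n%:R - n%:R) - (\sum_a xlnx (N a)%:R - n%:R) :> R.
  rewrite mulr_sumr (eq_bigr (fun a => xlnx (N a)%:R - (N a)%:R * ln n%:R)).
    by rewrite sumrB -mulr_suml sNR /xlnx; ring.
  by move=> a _; rewrite xlnx_div.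
by rewrite mulrA -ler_pdivrMr ?expR_gt0// -expRB.
Qed.

Lemma tclass_le n (N : A -> nat) : (0 < n)%N -> (\sum_a N a = n)%N ->
  #|tclass n N|%:R * expR (n%:R * \sum_a xlnx ((N a)%:R / n%:R)) <= 1 :> R.
Proof.
move=> n0 sN; pose f a : R := (N a)%:R / n%:R.
apply: (@card_le_prod R A n _ (fun=> f)) => [i a|i|s /tclassP sP].
- by rewrite divr_ge0.
- by rewrite -mulr_suml -natr_sum sN divff ?pnatr_eq0 -?lt0n.
- rewrite (prod_emp (f := f) n0) => [|i]; last by rewrite /f -sP emp_gt0.
  rewrite ler_expR le_eqVlt; apply/orP; left; apply/eqP; congr (_ * _).
  by apply: eq_bigr => a _; rewrite /xlnx /emp sP.
Qed.

End TypeSize.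

(** * Joint types of two words *)

Section JointTypes.
Variables (R : realType) (X Y : finType) (n : nat).
Implicit Types (x : n.-tuple X) (y : n.-tuple Y) (N : {ffun X * Y -> 'I_n.+1}).

Definition joint_tuple x y : n.-tuple (X * Y) := [tuple (tnth x i, tnth y i) | i < n].
(** Counts bounded by [n] make the joint types a finite type with [n.+1 ^ (|X| |Y|)] elements: sums
    range over it directly and its cardinality is the polynomial factor. *)
Definition joint_type x y : {ffun X * Y -> 'I_n.+1} := [ffun t => inord (cnt
  (joint_tuple x y) t)].
Definition joint_freq N : X * Y -> R := fun t => (N t)%:R / n%:R.

Lemma joint_typeE x y t : joint_type x y t = cnt (joint_tuple x y) t :> nat.
Proof.
rewrite ffunE inordK// ltnS -[leqRHS](sum_cnt (joint_tuple x y)).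
by rewrite (bigD1 t)//= leq_addr.
Qed.

Lemma joint_type_tclass x y N : (joint_type x y == N) = (joint_tuple x y \in tclass n
  (fun t => N t)).
Proof.
apply/eqP/tclassP => [<- t|h]; first by rewrite joint_typeE.
by apply/ffunP => t; apply: val_inj; rewrite /= joint_typeE h.
Qed.

Lemma cnt_joint_fst x y a : (\sum_b cnt (joint_tuple x y) (a, b) = cnt x a)%N.
Proof.
rewrite /cnt exchange_big; apply: eq_bigr => i _ /=; rewrite tnth_mktuple.
rewrite (bigD1 (tnth y i))//= big1 ?addn0; first by rewrite xpair_eqE eqxx andbT.
by move=> b /negbTE nb; rewrite xpair_eqE [tnth y i == b]eq_sym nb andbF.
Qed.

Lemma cnt_joint_snd x y b : (\sum_a cnt (joint_tuple x y) (a, b) = cnt y b)%N.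
Proof.
rewrite /cnt exchange_big; apply: eq_bigr => i _ /=; rewrite tnth_mktuple.
rewrite (bigD1 (tnth x i))//= big1 ?addn0; first by rewrite xpair_eqE eqxx.
by move=> a /negbTE na; rewrite xpair_eqE [tnth x i == a]eq_sym na.
Qed.

Lemma margY_joint_type x y b : margY (joint_freq (joint_type x y)) b = emp R y b.
Proof.
rewrite /margY /joint_freq -mulr_suml -natr_sum /emp -(cnt_joint_snd x); congr (_%:R / _).
by apply: eq_bigr => a _; rewrite joint_typeE.
Qed.

Lemma sum_joint_tuple (M : nmodType) (F : n.-tuple (X * Y) -> M) :
  \sum_z F z = \sum_y \sum_x F (joint_tuple x y).
Proof.
rewrite exchange_big pair_bigA/=.
rewrite (reindex (fun u : n.-tuple X * n.-tuple Y => joint_tuple u.1 u.2))//=.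
exists (fun z => (map_tuple fst z, map_tuple snd z)) => [[x y] _|z _].
  by congr (_, _); apply: eq_from_tnth => i; rewrite tnth_map tnth_mktuple.
apply: eq_from_tnth => i; rewrite tnth_mktuple !tnth_map.
by case: (tnth z i).
Qed.

(* For fixed [y] the conditional law [V (a, b) / V_Y b] gives the same
   probability to all [x] of joint type [N] with [y]. *)
Lemma cond_class_le N y : (0 < n)%N ->
  #|[set x | joint_type x y == N]|%:R *
    expR (n%:R * (nent (joint_freq N) - nentY (joint_freq N))) <= 1.
Proof.
move=> n0; pose V := joint_freq N.
pose c (t : X * Y) := V t / margY V t.2.
have V0 t : 0 <= V t by rewrite divr_ge0.
have m0 b : 0 <= margY V b by apply: sumr_ge0.
apply: (@card_le_prod R X n _ (fun i a => c (a, tnth y i))) => [i a|i|x].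
- by rewrite divr_ge0.
- rewrite /c /= -mulr_suml; have := m0 (tnth y i); rewrite le_eqVlt => /predU1P[e|e].
    by rewrite -e invr0 mulr0.
  by rewrite -/(margY V (tnth y i)) divff// gt_eqF.
rewrite inE => /eqP xN.
have Ve t : V t = emp R (joint_tuple x y) t by rewrite /V /joint_freq -xN joint_typeE.
have Vi i : 0 < V (tnth x i, tnth y i).
  by have := emp_gt0 R (joint_tuple x y) i; rewrite -Ve tnth_mktuple.
have mpos a b : 0 < V (a, b) -> 0 < margY V b.
  by move=> Vab; rewrite /margY (bigD1 a)//= ltr_wpDr ?sumr_ge0.
rewrite (eq_bigr (fun i => c (tnth (joint_tuple x y) i))); last first.
  by move=> i _; rewrite tnth_mktuple.
rewrite (prod_emp (f := c) n0) => [|i]; last first.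
  by rewrite /c tnth_mktuple divr_gt0//; exact: mpos (Vi i).
rewrite ler_expR ler_pM2l ?ltr0n// -/V.
rewrite [leRHS](eq_bigr (fun t => xlnx (V t) - V t * ln (margY V t.2))).
  by rewrite sumrB (sum_mul_snd V (fun b => ln (margY V b))).
move=> [a b] _; rewrite -Ve /c.
have := V0 (a, b); rewrite le_eqVlt => /predU1P[<-|Vt];
  first by rewrite xlnx0 !mul0r subr0.
by rewrite ln_div ?posrE ?(mpos _ _ Vt)// /xlnx mulrBr.
Qed.

End JointTypes.

(** * Non-asymptotic bounds on the expected deviation *)

Section Exponents.
Variables (R : realType) (X Y : finType) (P : X -> R) (W : X -> Y -> R) (Rt : R).
Hypotheses (HW : is_channel W) (HPd : is_dist P).
Variables (n M : nat).
Hypothesis n0 : (0 < n)%N.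
Implicit Types (x : n.-tuple X) (y : n.-tuple Y) (N : {ffun X * Y -> 'I_n.+1}).

Let TP := typeclass n P.
Hypothesis TP0 : (0 < #|TP|)%N.
Let B : R := expR 1 * n.+1%:R.
Let c := #|[the finType of (X * Y)%type]|.

Definition type_weight N : R := \prod_t W t.1 t.2 ^+ N t.
Definition unif x : R := if x \in typeclass n P then #|typeclass n P|%:R^-1 else 0.
Definition type_prob N y : R := \sum_(x | joint_type x y == N) unif x.

Let P0 a : 0 <= P a. Proof. by case: HPd. Qed.
Let W0 a b : 0 <= W a b. Proof. by case: (HW a). Qed.
Let n0R : 0 < n%:R :> R. Proof. by rewrite ltr0n. Qed.
Let TP0R : 0 < #|TP|%:R :> R. Proof. by rewrite ltr0n. Qed.

Lemma unif_ge0 x : 0 <= unif x.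
Proof. by rewrite /unif; case: ifP. Qed.

Lemma unif_sum1 : \sum_x unif x = 1.
Proof.
rewrite /unif -big_mkcond/= sumr_const -[_ *+ _]mulr_natl divff//.
by rewrite gt_eqF.
Qed.

Lemma type_weight_ge0 N : 0 <= type_weight N.
Proof. by apply: prodr_ge0 => t _; rewrite exprn_ge0. Qed.

Lemma type_prob_ge0 N y : 0 <= type_prob N y.
Proof. by apply: sumr_ge0 => x _; exact: unif_ge0. Qed.

Lemma chanN_type_weight x y : chanN W x y = type_weight (joint_type x y).
Proof.
rewrite /chanN /type_weight.
transitivity (\prod_(i < n) \prod_t W t.1 t.2 ^+ (tnth (joint_tuple x y) i == t)).
  apply: eq_bigr => i _; rewrite (bigD1 (tnth (joint_tuple x y) i))//= eqxx expr1 big1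
    ?mulr1.
    by rewrite tnth_mktuple.
  by move=> t; rewrite eq_sym => /negbTE ->.
rewrite exchange_big/=; apply: eq_bigr => t _.
by rewrite joint_typeE /cnt expr_sum.
Qed.

Lemma chanN_sum x y : chanN W x y = \sum_N type_weight N * (joint_type x y == N)%:R.
Proof.
rewrite chanN_type_weight (bigD1 (joint_type x y))//= eqxx mulr1 big1 ?addr0// => N.
by rewrite eq_sym => /negbTE ->; rewrite mulr0.
Qed.

Lemma outRY_unif y : outRY P W y = \sum_x unif x * chanN W x y.
Proof.
rewrite /outRY mulr_sumr big_mkcond/=; apply: eq_bigr => x _.
by rewrite /unif; case: ifP; rewrite ?mul0r.
Qed.

Lemma outRY_type_prob y : outRY P W y = \sum_N type_weight N * type_prob N y.
Proof.
rewrite outRY_unif; under eq_bigr do rewrite chanN_sum mulr_sumr.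
rewrite exchange_big/=; apply: eq_bigr => N _.
rewrite /type_prob mulr_sumr [RHS]big_mkcond/=; apply: eq_bigr => x _.
by case: eqP => _; rewrite ?mulr1 ?mulr0// mulrC.
Qed.

(** The restriction to codebooks in the type class is turned into a product weight [unif] that
    vanishes outside it, so that for each [y] the codewords become i.i.d. *)
Lemma expected_L1_iidE : (0 < M)%N -> expected_L1 n M P W =
  \sum_y M%:R^-1 * iidE unif (fun x => chanN W x y - outRY P W y) M Num.norm 0.
Proof.
move=> M0; have M0R : 0 < M%:R :> R by rewrite ltr0n.
rewrite /expected_L1; under eq_bigr do rewrite mulr_sumr.
rewrite exchange_big/=; apply: eq_bigr => y _.
rewrite -iidE_ffun mulr_sumr big_mkcond/=; apply: eq_bigr => d _.
case: ifPn => [/forallP dP|].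
  rewrite (eq_bigr (fun=> #|TP|%:R^-1)); last by move=> j _; rewrite /unif dP.
  rewrite prodr_const card_ord exprVn mulrCA; congr (_ * _).
  rewrite add0r sumrB sumr_const card_ord -[outRY P W y *+ M]mulr_natl.
  rewrite -[in RHS](gtr0_norm (_ : 0 < M%:R^-1)) ?invr_gt0// -normrM mulrBr.
  by rewrite mulKf// gt_eqF.
rewrite negb_forall => /existsP[j /negbTE dj].
by rewrite (bigD1 j)//= {1}/unif dj !mul0r mulr0.
Qed.

Lemma type_weight_expR N : (forall t, W t.1 t.2 = 0 -> N t = 0%N :> nat) ->
  type_weight N = expR (n%:R * mean_lnW W (joint_freq R N)).
Proof.
move=> NW; rewrite /mean_lnW mulr_sumr expR_sum; apply: eq_bigr => t _.
rewrite mulrA /joint_freq mulrCA divff ?gt_eqF// mulr1 expRM_natl.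
have := W0 t.1 t.2; rewrite le_eqVlt => /predU1P[e|Wt]; last by rewrite lnK.
by rewrite NW// !expr0.
Qed.

Lemma type_weight_neq0 N t : type_weight N != 0 -> W t.1 t.2 = 0 -> N t = 0%N :> nat.
Proof.
move=> + Wt; rewrite /type_weight (bigD1 t)//= Wt mulf_eq0 negb_or => /andP[+ _].
by case: (nat_of_ord (N t)) => // k; rewrite expr0n/= eqxx.
Qed.

Lemma typeclassP x : reflect (forall a, emp R x a = P a) (x \in TP).
Proof.
rewrite inE; apply: (iffP forallP) => h a; have := h a.
  by move/eqP; rewrite cnt_mem.
by rewrite cnt_mem => <-.
Qed.

Lemma admissible_freq x y : x \in TP -> type_weight (joint_type x y) != 0 -> admissible
  P W (joint_freq R (joint_type x y)).
Proof.
move=> /typeclassP xP w0; split=> [t|a|t Wt].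
- by rewrite divr_ge0.
- rewrite -xP /emp -(cnt_joint_fst x y a) /joint_freq -mulr_suml natr_sum.
  by congr (_ / _); apply: eq_bigr => b _; rewrite joint_typeE.
- by rewrite /joint_freq (type_weight_neq0 w0 Wt) mul0r.
Qed.

Lemma type_prob_neq0 N y : type_prob N y != 0 -> exists2 x, x \in TP & joint_type x y = N.
Proof.
move=> p0; have [/existsP[x /andP[xN xP]]|] := boolP [exists x, (joint_type x y == N)
  && (x \in TP)].
  by exists x => //; apply/eqP.
rewrite negb_exists => /forallP h; case/eqP: p0; apply: big1 => x xN.
by have := h x; rewrite xN/= /unif => /negbTE ->.
Qed.

Lemma typeclass_tclass x : x \in TP -> TP = tclass n (cnt x).
Proof.
move=> /typeclassP xP; apply/setP => x'; apply/typeclassP/tclassP => h a.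
  have := h a; rewrite -xP /emp => /(mulIf _) e; apply/eqP.
  by rewrite -(eqr_nat R) e// invr_neq0// gt_eqF.
by rewrite -xP /emp h.
Qed.

Lemma card_typeclass_ge : expR (- (n%:R * nentX P)) <= #|TP|%:R * B ^+ #|X|.
Proof.
case/card_gt0P: TP0 => x xP; rewrite (typeclass_tclass xP).
apply: le_trans (tclass_ge R n0 (sum_cnt x)).
by rewrite (eq_bigr (fun a => xlnx (P a)))// => a _; move/typeclassP: xP => <-.
Qed.

Lemma card_typeclass_le : #|TP|%:R * expR (n%:R * nentX P) <= 1.
Proof.
case/card_gt0P: TP0 => x xP; rewrite (typeclass_tclass xP).
apply: le_trans (tclass_le R n0 (sum_cnt x)).
by rewrite (eq_bigr (fun a => xlnx (P a)) (F1 := fun a => xlnx (_ / _)))// => a _;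
  move/typeclassP: xP => <-.
Qed.

Let B_ge1 : 1 <= B.
Proof.
rewrite /B -[leLHS]mulr1; apply: ler_pM => //; last by rewrite ler1n.
by rewrite -expR0 ler_expR.
Qed.
Let B_gt0 : 0 < B. Proof. exact: lt_le_trans B_ge1. Qed.
Let BX_gt0 k : 0 < B ^+ k. Proof. exact: exprn_gt0. Qed.

(** The probability that a random codeword has joint type [N] with [y]: the size of a conditional
    type class over that of the type class of [P]. *)
Lemma type_prob_le N y : type_prob N y <= B ^+ #|X| * expR (- (n%:R * minfo P
  (joint_freq R N))).
Proof.
have h1 : type_prob N y <= #|[set x | joint_type x y == N]|%:R / #|TP|%:R.
  rewrite mulr_natl -sumr_const /type_prob; apply: (@le_trans _ _ (\sum_(x | joint_type
    x y == N) #|TP|%:R^-1)).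
    by apply: ler_sum => x _; rewrite /unif; case: ifP.
  by rewrite le_eqVlt; apply/orP; left; apply/eqP; apply: eq_bigl => x; rewrite inE.
have h2 := @cond_class_le R X Y n N y n0.
have h3 := card_typeclass_ge.
apply: (le_trans h1); rewrite ler_pdivrMr//.
rewrite -ler_pdivlMr ?expR_gt0// div1r -expRN in h2.
apply: (le_trans h2).
have -> : - (n%:R * (nent (joint_freq R N) - nentY (joint_freq R N))) =
  - (n%:R * minfo P (joint_freq R N)) + - (n%:R * nentX P) by rewrite /minfo; ring.
rewrite expRD (mulrC (B ^+ _)) -mulrA ler_pM2l ?expR_gt0//.
by rewrite [leRHS]mulrC.
Qed.

(** All these [y] share one type, the second marginal of [N], so they lie in one type class. *)
Lemma card_y_le N : #|[set y | type_prob N y != 0]|%:R * expR (n%:R * nentY (joint_freq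
  R N)) <= 1.
Proof.
have [->|] := set_0Vmem [set y | type_prob N y != 0].
  by rewrite cards0 mul0r.
move=> [y0]; rewrite inE => /type_prob_neq0[x0 x0P x0N].
apply: le_trans (tclass_le R n0 (sum_cnt y0)).
have -> : \sum_b xlnx ((cnt y0 b)%:R / n%:R) = nentY (joint_freq R N).
  by rewrite /nentY -x0N; apply: eq_bigr => b _; rewrite margY_joint_type.
rewrite ler_pM2r ?expR_gt0// ler_nat; apply: subset_leq_card.
apply/fintype.subsetP => y; rewrite inE => /type_prob_neq0[x xP xN]; apply/tclassP => b.
by rewrite -(cnt_joint_snd x) -(cnt_joint_snd x0); apply: eq_bigr => a _;
  rewrite -!joint_typeE xN x0N.
Qed.

(** Counting pairs: the sum over [y] is the size of the joint type class divided by that of the type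
    class of [P]. No lower bound for individual [y] is needed. *)
Lemma sum_type_prob_ge N : (\sum_t N t = n)%N -> (forall a, \sum_b joint_freq R N (a,
  b) = P a) ->
  expR (- (n%:R * (nent (joint_freq R N) - nentX P))) <= (\sum_y type_prob N y) * B ^+ c.
Proof.
move=> sN NP.
have inTP x y : joint_type x y == N -> x \in TP.
  move=> /eqP xN; apply/typeclassP => a; rewrite -NP -xN /emp -(cnt_joint_fst x y a).
  by rewrite natr_sum mulr_suml; apply: eq_bigr => b _; rewrite /joint_freq joint_typeE.
have -> : \sum_y type_prob N y = #|tclass n (fun t => N t)|%:R / #|TP|%:R.
  rewrite -sum1_card natr_sum mulr_suml [RHS]big_mkcond/= sum_joint_tuple.
  apply: eq_bigr => y _; rewrite /type_prob big_mkcond/=; apply: eq_bigr => x _.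
  rewrite joint_type_tclass; case: ifP => // xN; rewrite /unif (inTP x y) ?mul1r//.
  by rewrite joint_type_tclass.
rewrite mulrAC ler_pdivlMr//.
apply: le_trans (tclass_ge R n0 sN).
have -> : - (n%:R * (nent (joint_freq R N) - nentX P)) = - (n%:R * nent (joint_freq R
  N)) + n%:R * nentX P by ring.
rewrite expRD -mulrA ler_piMr ?expR_ge0//.
by rewrite [leLHS]mulrC card_typeclass_le.
Qed.

(** * Matching upper and lower bounds on the expected deviation *)

Section Bounds.
Hypothesis R0 : 0 <= Rt.
Hypotheses (M_ge : expR (n%:R * Rt) <= M%:R) (M_le : M%:R <= 2 * expR (n%:R * Rt)).
Let M0R : 0 < M%:R :> R. Proof. exact: lt_le_trans (expR_gt0 _) M_ge. Qed.
Let M0 : (0 < M)%N. Proof. by rewrite -(ltr0n R). Qed.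

Variable L : R.
Hypothesis FL : forall V, admissible P W V -> L <= primal P W Rt V.

(** If [I <= Rt], the standard deviation gives the exponent [I + (Rt - I) / 2]; otherwise the mean
    gives [I]. The factor [k] stands for the polynomial loss. *)
Lemma min_dev_le (k I : R) : 1 <= k ->
  M%:R^-1 * Num.min (2 * (M%:R * (k * expR (- (n%:R * I)))))
             (Num.sqrt (M%:R * (k * expR (- (n%:R * I))))) <=
  2 * k * expR (- (n%:R * (I + 2^-1 * Num.max 0 (Rt - I)))).
Proof.
move=> k1; have k0 : 0 < k by lra.
case: (leP 0 (Rt - I)) => RI.
  apply: (@le_trans _ _ (M%:R^-1 * Num.sqrt (M%:R * (k * expR (- (n%:R * I)))))).
    by rewrite ler_pM2l ?invr_gt0// ge_min lexx orbT.
  rewrite ler_pdivrMl// -[leRHS]ger0_norm; last first.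
    by rewrite !mulr_ge0 ?expR_ge0// ltW.
  rewrite -sqrtr_sqr ler_wsqrtr//.
  have -> : (M%:R * (2 * k * expR (- (n%:R * (I + 2^-1 * (Rt - I)))))) ^+ 2 =
     M%:R * (k * expR (- (n%:R * I))) * (4 * k * (M%:R * expR (- (n%:R * Rt)))).
    have e2 : expR (- (n%:R * (I + 2^-1 * (Rt - I)))) ^+ 2 =
      expR (- (n%:R * I)) * expR (- (n%:R * Rt)).
      by rewrite -expRM_natl -expRD; congr expR; field.
    by rewrite !exprMn e2; ring.
  rewrite ler_peMr//; first by rewrite !mulr_ge0 ?expR_ge0// ltW.
  have : 1 <= M%:R * expR (- (n%:R * Rt)).
    by rewrite expRN ler_pdivlMr ?expR_gt0// mul1r.
  by nra.
rewrite mulr0 addr0.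
apply: (@le_trans _ _ (M%:R^-1 * (2 * (M%:R * (k * expR (- (n%:R * I))))))).
  by rewrite ler_pM2l ?invr_gt0// ge_min lexx.
rewrite le_eqVlt; apply/orP; left; apply/eqP; field; exact: lt0r_neq0.
Qed.

Lemma expected_L1_le : expected_L1 n M P W <=
  2 * n.+1%:R ^+ c * B ^+ #|X| * expR (- (n%:R * L)).
Proof.
rewrite expected_L1_iidE//.
pose D y N := type_weight N * Num.min (2 * (M%:R * type_prob N y)) (Num.sqrt (M%:R *
  type_prob N y)).
apply: (@le_trans _ _ (\sum_y M%:R^-1 * \sum_N D y N)).
  apply: ler_sum => y _; rewrite ler_pM2l ?invr_gt0//.
  rewrite (eq_iidE _ _ _ _ (Z' := fun x => \sum_N type_weight N * ((joint_type x y ==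
    N)%:R - type_prob N y))); last first.
    move=> x; rewrite chanN_sum outRY_type_prob -sumrB; apply: eq_bigr => N _.
    by rewrite mulrBr.
  have := @iidE_norm_sum R _ unif unif_ge0 _ (fun N x => type_weight N * ((joint_type x
    y == N)%:R - type_prob N y)) M (fun=> 0).
  rewrite big1// => /le_trans; apply; apply: ler_sum => N _.
  have := @iidE_norm_scale R _ unif (fun x => (joint_type x y == N)%:R - type_prob N y)
    M (type_weight N) 0.
  rewrite mulr0 => ->; rewrite ger0_norm ?type_weight_ge0// ler_wpM2l ?type_weight_ge0//.
  by have := iidE_indicator_le unif_ge0 unif_sum1 (A := fun x => joint_type x y == N)
    (p := type_prob N y) erefl M.
under eq_bigr do rewrite mulr_sumr.
rewrite exchange_big/=.
have -> : 2 * n.+1%:R ^+ c * B ^+ #|X| * expR (- (n%:R * L)) =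
   \sum_(N : {ffun X * Y -> 'I_n.+1}) 2 * B ^+ #|X| * expR (- (n%:R * L)).
  by rewrite sumr_const card_ffun card_ord -[RHS]mulr_natl natrX -/c; ring.
apply: ler_sum => N _.
have RHS0 : 0 <= 2 * B ^+ #|X| * expR (- (n%:R * L)).
  by rewrite !mulr_ge0 ?expR_ge0// ltW.
have [w0|w0] := eqVneq (type_weight N) 0.
  by rewrite big1// => y _; rewrite /D w0 mul0r mulr0.
pose S := [set y | type_prob N y != 0].
rewrite (bigID (mem S))/= [X in _ + X]big1 ?addr0; last first.
  move=> y; rewrite inE negbK => /eqP p0.
  by rewrite /D p0 !mulr0 sqrtr0 minxx !mulr0.
have [S0|[y0]] := set_0Vmem S.
  by rewrite S0 big1// => y; rewrite inE.
rewrite inE => /type_prob_neq0[x0 x0P x0N].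
have KV : admissible P W (joint_freq R N) by rewrite -x0N; apply: admissible_freq;
  rewrite // x0N.
set V := joint_freq R N in KV *.
have wE : type_weight N = expR (n%:R * mean_lnW W V) by apply: type_weight_expR => t;
  exact: type_weight_neq0.
set e := expR (- (n%:R * (minfo P V + 2^-1 * Num.max 0 (Rt - minfo P V)))).
apply: (@le_trans _ _ (\sum_(y in S) type_weight N * (2 * B ^+ #|X| * e))).
  apply: ler_sum => y _; rewrite /D mulrCA ler_wpM2l ?type_weight_ge0//.
  apply: le_trans (min_dev_le (minfo P V) _); last by rewrite exprn_ege1.
  rewrite ler_pM2l ?invr_gt0//; have pp := type_prob_le N y.
  have Mpp : M%:R * type_prob N y <= M%:R * (B ^+ #|X| * expR (- (n%:R * minfo P V))).
    by rewrite ler_pM2l.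
  rewrite le_min !ge_min; apply/andP; split; apply/orP; [left|right].
    by rewrite ler_pM2l.
  by rewrite ler_wsqrtr.
rewrite sumr_const -[_ *+ _]mulr_natl wE.
have h := card_y_le N; rewrite -/S -/V in h.
have -> : #|S|%:R * (expR (n%:R * mean_lnW W V) * (2 * B ^+ #|X| * e)) =
  (#|S|%:R * expR (n%:R * nentY V)) * (2 * B ^+ #|X| * expR (- (n%:R * primal P W Rt V))).
  have -> : - (n%:R * primal P W Rt V) = - (n%:R * nentY V) + n%:R * mean_lnW W V +
     - (n%:R * (minfo P V + 2^-1 * Num.max 0 (Rt - minfo P V))) by rewrite /primal
       /div_joint /minfo; ring.
  rewrite !expRD -/e [expR (- (n%:R * nentY V))]expRN.
  by field; rewrite gt_eqF ?expR_gt0.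
apply: (le_trans (ler_piMl _ h)); first by rewrite !mulr_ge0 ?expR_ge0// ltW.
rewrite ler_pM2l; last by rewrite !mulr_gt0.
by rewrite ler_expR lerN2 ler_pM2l// FL.
Qed.

(** As [[Rt - I]_+ <= Rt], every admissible law has divergence at least [L - Rt / 2]. All joint
    types realised with the same [y] have the same [nentY], so a single exponent bounds every
    term. *)
Lemma outRY_le N x y : x \in TP -> joint_type x y = N ->
  outRY P W y <= n.+1%:R ^+ c * B ^+ #|X| *
    expR (- (n%:R * (L - Rt / 2 - nentY (joint_freq R N)))).
Proof.
move=> xP xN; rewrite outRY_type_prob.
set e := expR _; have e0 : 0 < e := expR_gt0 _.
have -> : n.+1%:R ^+ c * B ^+ #|X| * e = \sum_(N : {ffun X * Y -> 'I_n.+1}) B ^+ #|X| * e.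
  by rewrite sumr_const card_ffun card_ord -[RHS]mulr_natl natrX -/c; ring.
apply: ler_sum => N' _.
have RHS0 : 0 <= B ^+ #|X| * e by rewrite ltW// mulr_gt0.
have [->|w0] := eqVneq (type_weight N') 0; first by rewrite mul0r.
have [->|p0] := eqVneq (type_prob N' y) 0; first by rewrite mulr0.
have [x' x'P x'N] := type_prob_neq0 p0.
have KV : admissible P W (joint_freq R N') by rewrite -x'N; apply: admissible_freq;
  rewrite // x'N.
have PsiE : nentY (joint_freq R N) = nentY (joint_freq R N').
  by rewrite /nentY -xN -x'N; apply: eq_bigr => b _; rewrite !margY_joint_type.
have -> : type_weight N' = expR (n%:R * mean_lnW W (joint_freq R N')).
  by apply: type_weight_expR => t; exact: type_weight_neq0.
apply: (le_trans (ler_wpM2l (expR_ge0 _) (type_prob_le N' y))).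
rewrite mulrCA -expRD ler_pM2l// ler_expR PsiE.
have := FL KV; have := minfo_ge0 HPd KV; rewrite /primal.
set V := joint_freq R N' => I0 FLV.
have D : L - Rt / 2 <= div_joint P W V.
  have : Num.max 0 (Rt - minfo P V) <= Rt by rewrite ge_max R0/=; lra.
  by lra.
have -> : n%:R * mean_lnW W V + - (n%:R * minfo P V) = - (n%:R * (div_joint P W V -
  nentY V)).
  by rewrite /div_joint /minfo; ring.
by rewrite lerN2 ler_pM2l// lerD2r.
Qed.

(** The factor [g] multiplying [p] satisfies [g <= 1] and [M p g ^+ 2 <= 1], which puts [M p g]
    below both [M p] and its square root. The 2 in [2 * k] comes from the upper bound on [M]. *)
Lemma min_dev_ge (k I p : R) : 1 <= k -> 0 <= p <= k * expR (- (n%:R * I)) ->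
  p * ((2 * k)^-1 * expR (- (n%:R * (2^-1 * Num.max 0 (Rt - I))))) <=
  M%:R^-1 * Num.min (M%:R * p) (Num.sqrt (M%:R * p)).
Proof.
move=> k1 /andP[p0 pk]; have k0 : 0 < k by lra.
set e := expR _; have e0 : 0 < e := expR_gt0 _.
have e1 : e <= 1.
  have m0 : 0 <= Num.max 0 (Rt - I) by rewrite le_max lexx.
  by rewrite -expR0 ler_expR oppr_le0 !mulr_ge0 ?(ltW n0R).
set g := (2 * k)^-1 * e.
have k20 : 0 < (2 * k)^-1 by rewrite invr_gt0 mulr_gt0.
have g0 : 0 <= g by rewrite ltW// mulr_gt0.
have k2 : (2 * k)^-1 <= 1 by rewrite invf_le1 ?mulr_gt0//; lra.
have g1 : g <= 1 by rewrite mulr_ile1// ?(ltW k20) ?(ltW e0).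
rewrite ler_pdivlMl// le_min; apply/andP; split.
  by rewrite ler_pM2l// ler_piMr.
have Mpg : 0 <= M%:R * (p * g).
  by apply: mulr_ge0 => //; exact: mulr_ge0 p0 g0.
rewrite -[leLHS](ger0_norm Mpg) -sqrtr_sqr ler_wsqrtr//.
have -> : (M%:R * (p * g)) ^+ 2 = (M%:R * p) * (M%:R * p * g ^+ 2) by ring.
rewrite ler_piMr ?mulr_ge0//.
have e2 : e ^+ 2 <= expR (- (n%:R * (Rt - I))).
  rewrite /e -expRM_natl ler_expR.
  have : n%:R * (Rt - I) <= n%:R * Num.max 0 (Rt - I).
    by rewrite ler_pM2l// le_max lexx orbT.
  by lra.
apply: (@le_trans _ _ ((2 * expR (n%:R * Rt)) * (k * expR (- (n%:R * I))) *
   ((2 * k)^-1 ^+ 2 * expR (- (n%:R * (Rt - I)))))).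
  have hA : M%:R * p <= 2 * expR (n%:R * Rt) * (k * expR (- (n%:R * I))).
    by apply: ler_pM.
  apply: (ler_pM _ _ hA); [by rewrite mulr_ge0|exact: sqr_ge0|].
  by rewrite /g exprMn ler_pM2l// exprn_gt0.
have -> : - (n%:R * (Rt - I)) = - (n%:R * Rt) + n%:R * I by ring.
rewrite expRD !expRN.
have -> : 2 * expR (n%:R * Rt) * (k * (expR (n%:R * I))^-1) *
    ((2 * k)^-1 ^+ 2 * ((expR (n%:R * Rt))^-1 * expR (n%:R * I))) = (2 * k)^-1.
  by field; rewrite !gt_eqF ?expR_gt0.
exact: k2.
Qed.

(** The smallness condition makes [outRY P W y] at most half of [type_weight N]. Then 3/32 is the
    3/8 of [iidE_dev_ge], halved once for this and once in [min_dev_ge]. *)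
Lemma expected_L1_ge N : (\sum_t N t = n)%N -> admissible P W (joint_freq R N) ->
  2 * (n.+1%:R ^+ c * B ^+ #|X| *
    expR (- (n%:R * (L - Rt / 2 - div_joint P W (joint_freq R N) + minfo P (joint_freq
      R N))))) <= 1 ->
  3 / 32 * expR (- (n%:R * primal P W Rt (joint_freq R N))) <=
  expected_L1 n M P W * (B ^+ c * B ^+ #|X|).
Proof.
move=> sN KV small; have [V0 VP VW] := KV.
have wE : type_weight N = expR (n%:R * mean_lnW W (joint_freq R N)).
  apply: type_weight_expR => t /VW /eqP; rewrite mulf_eq0 invr_eq0 (gt_eqF n0R) orbF.
  by rewrite pnatr_eq0 => /eqP.
have w0 : 0 < type_weight N by rewrite wE expR_gt0.
set V := joint_freq R N in KV small *.
pose e := expR (- (n%:R * (2^-1 * Num.max 0 (Rt - minfo P V)))).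
have e0 : 0 < e := expR_gt0 _.
pose K := 3 / 16 * type_weight N * ((2 * B ^+ #|X|)^-1 * e).
have K0 : 0 <= K by rewrite !mulr_ge0// ?invr_ge0 ?mulr_ge0// ltW.
have BX1 : 1 <= B ^+ #|X| by rewrite exprn_ege1.
have E_ge : K * \sum_y type_prob N y <= expected_L1 n M P W.
  rewrite expected_L1_iidE// mulr_sumr; apply: ler_sum => y _.
  have dev := iidE_dev_ge unif_ge0 unif_sum1 (A := fun x => joint_type x y == N) (p :=
    type_prob N y)
    erefl (f := fun x => chanN W x y) (w := type_weight N) M.
  rewrite /= -outRY_unif in dev.
  have := dev _ => /(_ _)/(ler_wpM2l (ltW (_ : 0 < M%:R^-1))) dev'.
  apply: le_trans (dev' _ _); last 2 first.
  - by rewrite invr_gt0.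
  - by move=> x /eqP xN; rewrite chanN_type_weight xN.
  have [p0|p0] := eqVneq (type_prob N y) 0.
    by rewrite p0 !mulr0 sqrtr0 minxx !mulr0.
  have [x xP xN] := type_prob_neq0 p0.
  have rw : outRY P W y <= type_weight N / 2.
    apply: (le_trans (outRY_le xP xN)).
    rewrite ler_pdivlMr//.
    rewrite -[leRHS]mulr1.
    apply: le_trans (ler_wpM2l (ltW w0) small).
    rewrite wE -/V.
    have -> : - (n%:R * (L - Rt / 2 - nentY V)) = n%:R * mean_lnW W V +
       - (n%:R * (L - Rt / 2 - div_joint P W V + minfo P V)) by rewrite /div_joint
         /minfo; ring.
    by rewrite expRD le_eqVlt; apply/orP; left; apply/eqP; ring.
  have dw : type_weight N / 2 <= `|type_weight N - outRY P W y|.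
    by apply: le_trans (ler_norm _); lra.
  rewrite [leRHS]mulrCA.
  have -> : K * type_prob N y = (3 / 8 * (type_weight N / 2)) *
     (type_prob N y * ((2 * B ^+ #|X|)^-1 * e)) by rewrite /K; field; rewrite gt_eqF.
  apply: ler_pM.
  - by rewrite !mulr_ge0// ltW.
  - by rewrite !mulr_ge0 ?type_prob_ge0 ?invr_ge0 ?mulr_ge0// ltW.
  - by rewrite ler_pM2l.
  - by apply: min_dev_ge => //; rewrite type_prob_ge0 type_prob_le.
have S_ge := sum_type_prob_ge sN VP; rewrite -/V in S_ge.
apply: (@le_trans _ _ (K * (\sum_y type_prob N y) * (B ^+ c * B ^+ #|X|))); last first.
  by rewrite ler_pM2r// mulr_gt0.
have -> : K * (\sum_y type_prob N y) * (B ^+ c * B ^+ #|X|) =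
  (3 / 32 * type_weight N * e) * ((\sum_y type_prob N y) * B ^+ c).
  by rewrite /K; field; rewrite gt_eqF.
apply: le_trans (ler_wpM2l _ S_ge); last by rewrite !mulr_ge0// ltW.
have -> : - (n%:R * primal P W Rt V) = n%:R * mean_lnW W V +
   - (n%:R * (2^-1 * Num.max 0 (Rt - minfo P V))) + - (n%:R * (nent V - nentX P)).
  by rewrite /primal /div_joint; ring.
by rewrite wE !expRD -/e -/V le_eqVlt; apply/orP; left; apply/eqP; ring.
Qed.

End Bounds.
End Exponents.

(** * Primal and dual objectives *)

Section ExtendedReals.
Variables (R : realType) (X Y : finType).
Variables (P : X -> R) (W : X -> Y -> R) (Rt : R).
Hypotheses (HW : is_channel W) (HPd : is_dist P).
Implicit Types (V : X * Y -> R).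

Let P0 a : 0 <= P a. Proof. by case: HPd. Qed.
Let W0 a b : 0 <= W a b. Proof. by case: (HW a). Qed.

Lemma KL_fin (T : finType) (p q : T -> R) :
  (forall t, 0 <= p t) -> (forall t, 0 <= q t) -> (forall t, q t = 0 -> p t = 0) ->
  KL p q = (\sum_t xlnx (p t) - \sum_t p t * ln (q t))%:E.
Proof.
move=> p0 q0 pq; rewrite /KL ifF; last first.
  by apply/existsP => -[t /andP[pt /eqP /pq e]]; rewrite e ltxx in pt.
congr (_%:E); rewrite -sumrB big_mkcond/=; apply: eq_bigr => t _.
have := p0 t; rewrite le_eqVlt => /predU1P[<-|pt]; first by rewrite ltxx xlnx0 mul0r
  subr0.
have qt : 0 < q t by rewrite lt_neqAle q0 andbT eq_sym; apply/eqP => /pq e;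
  rewrite e ltxx in pt.
by rewrite pt ln_div ?posrE// mulrBr.
Qed.

Lemma primal_obj_fin Q : admissible P W (joint P Q) -> (forall a b, 0 <= Q a b) ->
  primal_obj Rt P W Q = (primal P W Rt (joint P Q))%:E.
Proof.
move=> KV Q0; set V := joint P Q in KV *.
have V0 t : 0 <= V t by case: KV.
rewrite /primal_obj (KL_fin V0 (joint_ge0 HW HPd) (fun t => joint_eq0 KV)).
rewrite (@KL_fin _ V (prodd P (outdist P Q)) V0 (fun t => prodd_margY_ge0 HPd t KV)
  (fun t => prodd_margY_eq0 KV)).
rewrite (sum_ln_joint HW KV) -[prodd P _]/(prodd P (margY V)) (sum_ln_prodd_margY KV).
by rewrite -EFinB -EFin_max -EFinM -EFinD /primal /div_joint /minfo /nent !opprD !addrA.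
Qed.

Lemma mutinf_fin : mutinf P W = (minfo P (joint P W))%:E.
Proof.
have KV := admissible_joint HW HPd.
rewrite /mutinf (@KL_fin _ _ (prodd P (outdist P W)) (joint_ge0 HW HPd)
  (fun t => prodd_margY_ge0 HPd t KV) (fun t => prodd_margY_eq0 KV)).
rewrite -[prodd P _]/(prodd P (margY (joint P W))) (sum_ln_prodd_margY KV).
by rewrite /minfo /nent opprD addrA.
Qed.

Lemma primal_obj_infty Q : is_channel Q -> ~ admissible P W (joint P Q) ->
  primal_obj Rt P W Q = +oo%E.
Proof.
move=> HQ nK; rewrite /primal_obj [X in (X + _)%E](_ : _ = +oo%E); last first.
  rewrite /KL ifT//; apply/existsP; apply/not_existsP => h; apply: nK.
  split=> [t|a|t Wt]; first by rewrite mulr_ge0//; case: (HQ t.1).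
    by rewrite /joint/= -mulr_sumr; case: (HQ a) => _ ->; rewrite mulr1.
  apply/le_anti; rewrite [X in _ && X]mulr_ge0//; last by case: (HQ t.1).
  rewrite andbT leNgt; apply/negP => V0; apply: (h t).
  by rewrite V0 /joint Wt mulr0 eqxx.
rewrite addye// gt_eqF// (@lt_le_trans _ _ 0%E) ?ltNyr// mule_ge0//.
by rewrite le_max lexx.
Qed.

Lemma primal_attained V : admissible P W V ->
  exists Q, is_channel Q /\ primal_obj Rt P W Q = (primal P W Rt V)%:E.
Proof.
move=> KV; have [V0 VP VW] := KV.
(* On inputs of probability 0 any law would do for the objective; [W a] makes [Q] a channel. *)
pose Q a b := if P a == 0 then W a b else V (a, b) / P a.
have Q0 a b : 0 <= Q a b by rewrite /Q; case: ifP => _ //; rewrite divr_ge0.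
have HQ : is_channel Q.
  move=> a; split=> //; rewrite /Q; case: eqP => [_|/eqP Pa]; first by case: (HW a).
  by rewrite -mulr_suml VP divff.
have VE : joint P Q = V.
  apply/funext => -[a b]; rewrite /joint /Q /=; case: eqP => [e|/eqP Pa].
    rewrite e mul0r; apply/le_anti; rewrite V0/= -e.
    by have := admissible_le (a, b) KV; rewrite /= e.
  by rewrite mulrC divfK.
by exists Q; split=> //; rewrite primal_obj_fin ?VE.
Qed.

(** * Variational formula for the Renyi divergence *)

Section Dual.
Variables (l : R) (S : Y -> R).
Hypothesis l1 : 1 < l.

Let U a b : R := if 0 < W a b then W a b `^ l * S b `^ (1 - l) else 0.
Let A a : R := \sum_b U a b.

Hypothesis WS : forall a b, 0 < P a -> 0 < W a b -> 0 < S b.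

Let U_ge0 a b : 0 <= U a b.
Proof. by rewrite /U; case: ifP => // _; rewrite mulr_ge0 ?powR_ge0. Qed.

Let U_gt0 a b : 0 < P a -> 0 < W a b -> 0 < U a b.
Proof. by move=> Pa Wab; rewrite /U Wab mulr_gt0 ?powR_gt0 ?(WS Pa Wab). Qed.

Let A_gt0 a : 0 < P a -> 0 < A a.
Proof.
move=> Pa; rewrite lt_neqAle sumr_ge0 ?andbT// eq_sym; apply/eqP => A0.
have : \sum_b W a b = 0.
  apply: big1 => b _; apply/eqP; rewrite eq_le W0 andbT leNgt; apply/negP => Wab.
  by have := U_gt0 Pa Wab; rewrite (psumr_eq0P _ A0)// ltxx.
by case: (HW a) => _ ->; apply/eqP; rewrite oner_eq0.
Qed.

(* The tilted joint law [P_X(x) W(y|x)^l S(y)^(1-l) / A_x], optimal in the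
   variational formula for the Renyi divergence. *)
Definition tilted : X * Y -> R := fun t => P t.1 * (U t.1 t.2 / A t.1).

Lemma admissible_tilted : admissible P W tilted.
Proof.
split=> [t|a|t Wt]; rewrite /tilted.
- by rewrite !mulr_ge0// invr_ge0 sumr_ge0.
- have := P0 a; rewrite le_eqVlt => /predU1P[<-|Pa].
    by apply: big1 => b _; rewrite /= mul0r.
  by rewrite /= -mulr_sumr -mulr_suml divff ?mulr1// gt_eqF// A_gt0.
- by rewrite /U Wt ltxx mul0r mulr0.
Qed.

Let rsum : R := (l - 1)^-1 * \sum_a P a * ln (A a).

Lemma sum_ln_tilted V : admissible P W V ->
  \sum_t V t * ln (tilted t) =
  nentX P + l * mean_lnW W V + (1 - l) * \sum_b margY V b * ln (S b) - (l - 1) * rsum.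
Proof.
move=> KV; have [V0 VP VW] := KV.
rewrite /rsum mulVKf ?gt_eqF ?subr_gt0//.
rewrite (eq_bigr (fun t => V t * ln (P t.1) + l * (V t * ln (W t.1 t.2)) +
   (1 - l) * (V t * ln (S t.2)) - V t * ln (A t.1))).
  rewrite sumrB !big_split/= -!mulr_sumr (sum_mul_fst (fun a => ln (P a)) KV).
  by rewrite (sum_mul_fst (fun a => ln (A a)) KV) (sum_mul_snd V (fun b => ln (S b))).
move=> [a b] _; have := V0 (a, b); rewrite le_eqVlt => /predU1P[<-|Vt].
  by rewrite !mul0r; ring.
have Pa : 0 < P a := lt_le_trans Vt (admissible_le (a, b) KV).
have Wab : 0 < W a b.
  rewrite lt_neqAle W0 andbT eq_sym; apply/eqP => /(VW (a, b)) e.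
  by rewrite e ltxx in Vt.
have Sb := WS Pa Wab.
rewrite /tilted /= lnM ?posrE ?divr_gt0 ?U_gt0 ?A_gt0//.
rewrite ln_div ?posrE ?U_gt0 ?A_gt0// /U Wab lnM ?posrE ?powR_gt0// !ln_powR.
by ring.
Qed.

(** Gibbs' inequality for [V] against [tilted], divided by [l]; hence equality at [V = tilted], as
    stated next. *)
Lemma renyi_variational V : admissible P W V ->
  (l - 1) / l * (nent V - nentX P - \sum_b margY V b * ln (S b)) - div_joint P W V <=
  (l - 1) / l * rsum.
Proof.
move=> KV; have [V0 VP VW] := KV.
have l0 : 0 < l := lt_trans ltr01 l1.
have h : \sum_t V t * ln (tilted t) <= nent V.
  have [t0 tP _] := admissible_tilted.
  apply: gibbs => //.
    move=> [a b]; rewrite /tilted /= => /eqP; rewrite mulf_eq0 => /orP[/eqP e|].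
      by apply/le_anti; rewrite V0 andbT -e (admissible_le (a, b) KV).
    rewrite mulf_eq0 => /orP[|].
      rewrite /U; case: ltP => [Wab|Wab _].
        have := P0 a; rewrite le_eqVlt => /predU1P[e _|Pa].
          by apply/le_anti; rewrite V0 andbT e (admissible_le (a, b) KV).
        by rewrite mulf_eq0 !gt_eqF ?powR_gt0 ?(WS Pa Wab).
      by apply: VW; apply/le_anti; rewrite Wab W0.
    have := P0 a; rewrite le_eqVlt => /predU1P[e _|Pa].
      by apply/le_anti; rewrite V0 andbT e (admissible_le (a, b) KV).
    by rewrite invr_eq0 gt_eqF ?A_gt0.
  by rewrite !sum_pair; apply: ler_sum => a _; rewrite tP VP.
rewrite (sum_ln_tilted KV) in h.
have le x : l * ((l - 1) / l * x) = (l - 1) * x by field; rewrite gt_eqF.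
rewrite -(ler_pM2l l0) mulrBr !le.
by rewrite /div_joint; lra.
Qed.

Lemma renyi_variational_tilted :
  (l - 1) / l * (nent tilted - nentX P - \sum_b margY tilted b * ln (S b)) -
    div_joint P W tilted = (l - 1) / l * rsum.
Proof.
have l0 : 0 < l := lt_trans ltr01 l1.
have h := sum_ln_tilted admissible_tilted; rewrite -/(nent tilted) in h.
apply: (mulfI (lt0r_neq0 l0)).
have le x : l * ((l - 1) / l * x) = (l - 1) * x by field; rewrite gt_eqF.
rewrite mulrBr !le.
by rewrite /div_joint; lra.
Qed.

Lemma sum_renyi : (\sum_x (P x)%:E * renyi l (W x) S)%E = rsum%:E.
Proof.
rewrite /rsum mulr_sumr -sumEFin; apply: eq_bigr => a _.
have := P0 a; rewrite le_eqVlt => /predU1P[<-|Pa].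
  by rewrite mul0e mul0r mulr0.
rewrite /renyi (gt_eqF l1) l1 /= ifF; last first.
  by apply/existsP => -[b /andP[Wab /eqP e]]; have := WS Pa Wab; rewrite e ltxx.
rewrite -EFinM mulrCA; congr (_ * (_ * ln _))%:E.
by rewrite /A /U big_mkcond.
Qed.

End Dual.

Lemma dual_obj_le l V : 1 <= l <= 2 -> admissible P W V ->
  0 <= primal P W Rt V -> (dual_obj Rt P W l <= (primal P W Rt V)%:E)%E.
Proof.
move=> /andP[l1 l2] KV F0; rewrite /dual_obj.
move: l1; rewrite le_eqVlt => /predU1P[<-|l1].
  by rewrite subrr mul0r mul0e lee_fin.
have l0 : 0 < l by lra.
have r0 : 0 < (l - 1) / l by rewrite divr_gt0//; lra.
have r1 : (l - 1) / l <= 2^-1 by rewrite ler_pdivrMr//; lra.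
set r := (l - 1) / l in r0 r1 *.
(* A real lower bound, valid for each [S], passes to the infimum and leaves only finite or [+oo]
   values of [csiszar] to inspect. *)
have lb : ((Rt - primal P W Rt V / r)%:E <= csiszar l P W)%E.
  apply: le_ereal_inf_tmp => _ [S [HS ->]].
  have [WS|] := pselect (forall a b, 0 < P a -> 0 < W a b -> 0 < S b).
    rewrite (sum_renyi l1 WS) lee_fin.
    have h := renyi_variational l1 WS KV; rewrite -/r in h.
    have hG : lagrangian P W Rt r V <= primal P W Rt V by apply: lagrangian_le_primal;
      rewrite (ltW r0).
    have gS : \sum_b margY V b * ln (S b) <= nentY V.
      have [S0 S1] := HS; apply: gibbs => // [b|b Sb|].
      - exact: margY_ge0 KV.
      - apply: big1 => a _; apply/le_anti; case: (KV) => V0 _ VW.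
        rewrite V0 andbT leNgt; apply/negP => Vab.
        have Pa : 0 < P a := lt_le_trans Vab (admissible_le (a, b) KV).
        have Wab : 0 < W a b.
          rewrite lt_neqAle W0 andbT eq_sym; apply/eqP => /(VW (a, b)) e.
          by rewrite e ltxx in Vab.
        by have := WS a b Pa Wab; rewrite Sb ltxx.
      - by rewrite S1 (sum_margY HPd KV).
    rewrite -(ler_pM2l r0) mulrBr [r * (_ / _)]mulrCA divff ?gt_eqF// mulr1.
    have : r * (nent V - nentX P - nentY V) <= r * (nent V - nentX P - \sum_b margY V b
      * ln (S b)).
      by rewrite ler_pM2l//; lra.
    by move: hG; rewrite /lagrangian /minfo; lra.
  (* Here [S] misses an output that [W] reaches from the support of [P], so the divergence of that
     row is [+oo]; no other row is [-oo], and the whole sum is infinite. *)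
  move=> /existsNP[a /existsNP[b /not_implyP[Pa /not_implyP[Wab Sb]]]].
  have Sb0 : S b = 0 by apply/le_anti; rewrite leNgt; case: HS => -> _; rewrite andbT;
    apply/negP.
  have renyiNy x : renyi l (W x) S != -oo%E by rewrite /renyi (gt_eqF l1); case: ifP.
  have PrNy x : ((P x)%:E * renyi l (W x) S)%E != -oo%E.
    have := renyiNy x; case: (renyi l (W x) S) => [z||]//= _.
    have := P0 x; rewrite le_eqVlt => /predU1P[<-|Px]; first by rewrite mul0e.
    by rewrite gt0_muley ?lte_fin.
  rewrite (bigD1 a)//= [X in ((P a)%:E * X)%E](_ : _ = +oo%E); last first.
    rewrite /renyi (gt_eqF l1) l1 /= ifT//; apply/existsP; exists b.
    by rewrite Wab Sb0 eqxx.
  rewrite gt0_muley ?lte_fin// addye ?leey//.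
  by apply/negP => /eqP/esum_eqNyP[x [_ _ /eqP]]; rewrite (negbTE (PrNy x)).
move: lb; case: (csiszar l P W) => [z||]; rewrite ?leeNy_eq//.
  rewrite lee_fin => lb; rewrite -EFinB -EFinM lee_fin.
  rewrite -ler_pdivlMl// mulrC; lra.
by move=> _; rewrite /= gt0_muleNy ?lte_fin// leNye.
Qed.

(** The multiplier [r] corresponds to the order [l = (1 - r)^-1]. At [r = 0] the Lagrangian is the
    divergence, which vanishes at the true channel; the minimum is then 0, the dual value at
    [l = 1]. *)
Lemma dual_attained V0 : 0 <= primal P W Rt V0 -> admissible P W V0 ->
  (forall V, admissible P W V -> primal P W Rt V0 <= primal P W Rt V) ->
  exists l, 1 <= l <= 2 /\ dual_obj Rt P W l = (primal P W Rt V0)%:E.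
Proof.
move=> F0 KV0 V0min.
have [r /andP[r0 r1] rG] := exists_weight V0min.
have GF : lagrangian P W Rt r V0 <= primal P W Rt V0 by apply: lagrangian_le_primal;
  rewrite r0.
move: r0; rewrite le_eqVlt => /predU1P[r0|r0].
  exists 1; split; first by lra.
  rewrite /dual_obj subrr mul0r mul0e; congr (_%:E); apply/le_anti; rewrite F0/=.
  by have := rG _ (admissible_joint HW HPd); rewrite -r0 /lagrangian mul0r addr0
    (div_joint_joint HW HPd).
have r01 : 0 < r <= 2^-1 by rewrite r0.
have Gmin V : admissible P W V -> lagrangian P W Rt r V0 <= lagrangian P W Rt r V.
  by move=> KV; apply: le_trans (rG _ KV).
pose l := (1 - r)^-1.
have q0 : 0 < 1 - r by lra.
have l0 : 0 < l by rewrite invr_gt0.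
have lr : (l - 1) / l = r by rewrite /l; field; rewrite gt_eqF.
have l12 : 1 <= l <= 2.
  by rewrite /l -[X in X <= _ <= _]invr1 lef_pV2 ?posrE//; apply/andP; split;
    [lra|rewrite -[2]invrK lef_pV2 ?posrE//; lra].
have l1 : 1 < l by rewrite /l invf_gt1//; lra.
exists l; split=> //; apply/le_anti; rewrite dual_obj_le//=.
pose S := margY V0.
have HS : is_dist S by split=> [b|]; [exact: (margY_ge0 b KV0)|rewrite -[RHS](sum_margY
  HPd KV0)].
have WS a b : 0 < P a -> 0 < W a b -> 0 < S b.
  move=> Pa Wab; rewrite lt_neqAle eq_sym (margY_ge0 b KV0) andbT; apply/eqP => Sb.
  have := minimizer_support r01 KV0 Gmin (admissible_joint HW HPd) Sb.
  move=> /(margY_eq0 a (admissible_joint HW HPd)) /eqP; rewrite /joint /= mulf_eq0.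
  by rewrite !gt_eqF.
(* At the tilted law the linearised bound becomes [r * (Rt - rsum)], so this [S] witnesses that the
   dual value is at least the primal one. *)
have h := minimizer_dual HPd r01 KV0 Gmin (admissible_tilted l WS).
have := renyi_variational_tilted l1 WS; rewrite lr => hr.
apply: (@le_trans _ _ (r%:E * (Rt%:E - (\sum_x (P x)%:E * renyi l (W x) S)%E))%E).
  rewrite (sum_renyi l1 WS) -EFinB -EFinM lee_fin.
  by have := rG _ KV0; move: h; rewrite -/S; lra.
rewrite /dual_obj lr lee_pmul2l ?lte_fin// leeB//.
by apply: ereal_inf_lbound; exists S.
Qed.

End ExtendedReals.

(** * The limit *)

Section Rounding.
Variables (R : realType) (X Y : finType) (P : X -> R) (W : X -> Y -> R).
Hypothesis HPd : is_dist P.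

(** Round each entry down and put the deficit of row [a] on one [b] in the support of [V]. Row sums
    stay exact because [n P a] is an integer, and zeros of the channel stay zeros. The error counts
    1 for the rounding and at most [#|Y|] for the deficit. *)
Lemma rounding n (na : X -> nat) (V : X * Y -> R) : (0 < n)%N ->
  (forall a, (na a)%:R = n%:R * P a) -> admissible P W V ->
  exists N : {ffun X * Y -> 'I_n.+1}, [/\ (\sum_t N t = n)%N, admissible P W
    (joint_freq R N) &
    forall t, `|joint_freq R N t - V t| <= #|Y|.+1%:R / n%:R].
Proof.
move=> n0 naE KV; have [V0 VP VW] := KV; have n0R : 0 < n%:R :> R by rewrite ltr0n.
pose fl a b := Num.truncn (n%:R * V (a, b)).
have nV0 a b : 0 <= n%:R * V (a, b) by rewrite mulr_ge0.
have fl_le a b : (fl a b)%:R <= n%:R * V (a, b) by rewrite /fl truncn_le.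
have fl_gt a b : n%:R * V (a, b) < (fl a b)%:R + 1 by rewrite natr1 truncnS_gt.
have sum_nV a : \sum_b n%:R * V (a, b) = (na a)%:R by rewrite -mulr_sumr VP naE.
have sum_fl a : (\sum_b fl a b <= na a)%N.
  by rewrite -(ler_nat R) natr_sum -sum_nV; apply: ler_sum.
pose ex a := (na a - \sum_b fl a b)%N.
have ex_le a : (ex a)%:R <= #|Y|%:R :> R.
  rewrite natrB// -sum_nV natr_sum -sumrB -sum1_card natr_sum.
  by apply: ler_sum => b _; have := fl_gt a b; lra.
pose b0 a := [pick b | 0 < V (a, b)].
have b0_None a : b0 a = None -> forall b, V (a, b) = 0.
  rewrite /b0; case: pickP => // h _ b; apply/le_anti; rewrite V0 andbT.
  by have := h b; rewrite /= ltNge => /negbFE.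
pose N0 t := (fl t.1 t.2 + (b0 t.1 == Some t.2) * ex t.1)%N.
have row a : (\sum_b N0 (a, b) = na a)%N.
  rewrite /N0 big_split/= -big_distrl/=.
  case bE : (b0 a) => [b|].
    rewrite [X in (_ + X * _)%N](bigD1 b)//= eqxx [X in (_ + (_ + X) * _)%N]big1.
      by rewrite addn0 mul1n subnKC.
    move=> b' nb.
    by case: eqP => // -[e]; rewrite e eqxx in nb.
  rewrite [X in (_ + X * _)%N]big1// mul0n addn0.
  have na0 : (na a)%:R = 0 :> R.
    by rewrite -sum_nV big1// => b _; rewrite b0_None// mulr0.
  apply/eqP; rewrite eqn_leq sum_fl/=; move/eqP: na0; rewrite pnatr_eq0 => /eqP ->.
  by [].
have sumN0 : (\sum_t N0 t = n)%N.
  apply/eqP; rewrite -(eqr_nat R) sum_pair; apply/eqP.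
  rewrite (eq_bigr na) // natr_sum (eq_bigr _ (fun a _ => naE a)) -mulr_sumr.
  by case: HPd => _ ->; rewrite mulr1.
have N0_le t : (N0 t <= n)%N by rewrite -sumN0 (bigD1 t)//= leq_addr.
pose N : {ffun X * Y -> 'I_n.+1} := [ffun t => inord (N0 t)].
have NE t : N t = N0 t :> nat.
  by rewrite ffunE inordK// ltnS.
have VnE t : joint_freq R N t = (N0 t)%:R / n%:R by rewrite /joint_freq NE.
exists N; split.
- by under eq_bigr do rewrite NE.
- split=> [t|a|[a b] Wt]; first by rewrite VnE divr_ge0.
    under eq_bigr do rewrite VnE.
    by rewrite -mulr_suml -natr_sum row naE mulrAC divff ?mul1r// gt_eqF.
  have Vt := VW _ Wt; rewrite VnE /N0 /= /fl Vt mulr0 truncn0 add0n.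
  case: eqP => [|_]; last by rewrite mul0n mul0r.
  by rewrite /b0; case: pickP => // b' + [e]; rewrite e Vt ltxx.
- move=> [a b]; rewrite VnE ler_pdivlMr// -[X in _ * X](gtr0_norm n0R) -normrM mulrBl.
  rewrite divfK ?gt_eqF// natrD natrM [V _ * _]mulrC.
  have h1 := fl_le a b; have h2 := fl_gt a b; have h3 := ex_le a.
  have h4 : 0 <= ((b0 a == Some b)%:R * (ex a)%:R : R) <= (ex a)%:R.
    by case: eqP => _; rewrite ?mul0r ?mul1r ?lexx ler0n.
  by rewrite ler_norml -natr1 /=; lra.
Qed.

End Rounding.

Section CodeSize.
Variable R : realType.

(** The ceiling adds at most 1, and 1 is at most the exponential because the rate is nonnegative. *)
Lemma ncode_bounds (Rt : R) n : 0 <= Rt ->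
  expR (n%:R * Rt) <= (ncode Rt n)%:R <= 2 * expR (n%:R * Rt).
Proof.
move=> R0; have e1 : 1 <= expR (n%:R * Rt) by rewrite -expR0 ler_expR mulr_ge0.
have c0 : 0 <= Num.ceil (expR (n%:R * Rt)) by rewrite ceil_ge0; lra.
rewrite /ncode natr_absz ger0_norm//.
by have := ceil_itv (expR (n%:R * Rt)); rewrite intrD; lra.
Qed.

End CodeSize.

Section Limit.
Local Open Scope classical_set_scope.
Variables (R : realType) (X Y : finType).
Variables (P : X -> R) (W : X -> Y -> R) (Rt : R).
Hypotheses (HW : is_channel W) (HPd : is_dist P) (R0 : 0 <= Rt).
Let c := #|[the finType of (X * Y)%type]|.
Let kap : R := (c + #|X|)%N%:R.

(** All polynomial losses on the exponential scale. The 4 absorbs the constants 2 and 32/3, as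
    [expR 4 >= 16]. *)
Definition slack (n : nat) : R := (kap * ln (expR 1 * n.+1%:R) + 4) / n%:R.

Lemma poly_le_expR n (B := expR 1 * n.+1%:R : R) : (0 < n)%N ->
  2 * (B ^+ c * B ^+ #|X|) <= expR (n%:R * slack n) /\
  32 / 3 * (B ^+ c * B ^+ #|X|) <= expR (n%:R * slack n).
Proof.
move=> n0; have n0R : 0 < n%:R :> R by rewrite ltr0n.
have B0 : 0 < B by rewrite mulr_gt0 ?expR_gt0 ?ltr0n.
have -> : n%:R * slack n = kap * ln B + 4 by rewrite /slack mulrC divfK// gt_eqF.
rewrite expRD -exprD.
have -> : expR (kap * ln B) = B ^+ (c + #|X|) by rewrite expRM_natl lnK.
have e4 : 16 <= expR 4 :> R.
  have -> : 4 = 4%:R * 1 :> R by rewrite mulr1.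
  rewrite expRM_natl (_ : 16 = 2 ^+ 4); last by rewrite -natrX.
  rewrite lerXn2r ?nnegrE ?expR_ge0//.
  by have := expR_ge1Dx (1 : R); lra.
rewrite [X in _ /\ _ <= X]mulrC [X in _ <= X /\ _]mulrC.
by split; rewrite ler_pM2r ?exprn_gt0//; lra.
Qed.

(** From [ln q <= q] with [q] the square root of [n.+1]. Stating the bound in [k < n] makes it
    usable along any sequence of lengths exceeding their index. *)
Lemma slack_le n k : (k < n)%N ->
  slack n <= kap * (harmonic k + 2 * Num.sqrt (2 * harmonic k)) + 4 * harmonic k.
Proof.
move=> kn; have n0 : (0 < n)%N by exact: leq_ltn_trans kn.
have n0R : 0 < n%:R :> R by rewrite ltr0n.
have n1R : 0 < n.+1%:R :> R by rewrite ltr0n.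
have nV : n%:R^-1 <= harmonic k :> R by rewrite lef_pV2 ?posrE ?ltr0n// ler_nat.
rewrite /slack lnM ?posrE ?expR_gt0// expRK mulrDl -mulrA; apply: lerD; last first.
  by rewrite ler_pM2l.
rewrite ler_wpM2l// mulrDl mul1r lerD//.
pose q : R := Num.sqrt n.+1%:R.
have q0 : 0 < q by rewrite sqrtr_gt0.
have qE : n.+1%:R = q ^+ 2 by rewrite sqr_sqrtr.
have lnq : ln n.+1%:R <= 2 * q.
  rewrite qE lnXn//; have := ln_sublinear q0; lra.
apply: (@le_trans _ _ (2 * q / n%:R)); first by rewrite ler_pM2r ?invr_gt0.
rewrite -mulrA ler_pM2l//.
rewrite -[leLHS]ger0_norm ?divr_ge0 ?(ltW q0)// -sqrtr_sqr ler_wsqrtr//.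
rewrite exprMn -qE exprVn; apply: (@le_trans _ _ (2 * n%:R^-1)); last first.
  by rewrite ler_pM2l.
rewrite -ler_pdivrMr ?invr_gt0// invrK -mulrA.
have -> : n%:R ^- 2 * n%:R = n%:R^-1 :> R by field; rewrite gt_eqF.
by rewrite ler_pdivrMr// -natrM ler_nat mul2n -addnn -addn1 leq_add2l.
Qed.

Lemma slack_cvg (n_ : nat -> nat) : (forall k, (k < n_ k)%N) ->
  slack (n_ k) @[k --> \oo] --> 0.
Proof.
move=> kn.
have h : (kap * (harmonic k + 2 * Num.sqrt (2 * harmonic k)) + 4 * harmonic k)
    @[k --> \oo] --> (0 : R).
  have h0 := @cvg_harmonic R.
  have h2 : 2 * harmonic k @[k --> \oo] --> (0 : R).
    by rewrite -[X in _ --> X](mulr0 2); apply: cvgM => //; exact: cvg_cst.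
  have hs : Num.sqrt (2 * harmonic k) @[k --> \oo] --> (0 : R).
    rewrite -[X in _ --> X]sqrtr0.
    apply: (@cvg_comp _ _ _ (fun k => 2 * harmonic k) (@Num.sqrt R) \oo (nbhs 0)) => //.
    exact: sqrt_continuous.
  rewrite -[X in _ --> X](_ : kap * (0 + 2 * 0) + 4 * 0 = 0); last by ring.
  apply: cvgD; apply: cvgM; try exact: cvg_cst; last exact: h0.
  by apply: cvgD => //; apply: cvgM => //; exact: cvg_cst.
apply: (@squeeze_cvgr _ _ _ R (fun=> 0) _ _ _ _ (cvg_cst _) h).
near=> k; rewrite slack_le// andbT /slack divr_ge0// addr_ge0// mulr_ge0//.
rewrite ln_ge0// -[leLHS]mulr1; apply: ler_pM => //; last by rewrite ler1n.
by rewrite -expR0 ler_expR.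
Unshelve. all: by end_near.
Qed.

Variables (L : R) (n M : nat).
Hypothesis FL : forall V, admissible P W V -> L <= primal P W Rt V.
Hypotheses (n0 : (0 < n)%N) (TP0 : (0 < #|typeclass n P|)%N).
Hypothesis M_bounds : expR (n%:R * Rt) <= M%:R <= 2 * expR (n%:R * Rt).
Let E := expected_L1 n M P W.

(** Positivity of [E] matters because [ln 0] is 0; [rate_le] supplies it for large [n]. *)
Lemma rate_ge : 0 < E -> L - slack n <= - (n%:R^-1 * ln E).
Proof.
move=> E0; have n0R : 0 < n%:R :> R by rewrite ltr0n.
have /andP[M1 M2] := M_bounds.
have h : E <= expR (n%:R * slack n - n%:R * L).
  apply: (le_trans (expected_L1_le HW n0 TP0 M1 FL)).
  rewrite expRD; apply: ler_wpM2r; first exact: expR_ge0.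
  apply: le_trans (proj1 (poly_le_expR n0)).
  rewrite -mulrA ler_pM2l// ler_pM2r ?exprn_gt0 ?mulr_gt0 ?expR_gt0 ?ltr0n//.
  rewrite lerXn2r ?nnegrE ?mulr_ge0 ?expR_ge0// ler_peMl//.
  by rewrite -expR0 ler_expR.
have : ln E <= n%:R * (slack n - L).
  by rewrite mulrBr -[leRHS]expRK ler_ln ?posrE ?expR_gt0.
by rewrite -ler_pdivrMl//; lra.
Qed.

Lemma rate_le (N : {ffun X * Y -> 'I_n.+1}) : (\sum_t N t = n)%N ->
  admissible P W (joint_freq R N) ->
  slack n <= L - Rt / 2 - div_joint P W (joint_freq R N) + minfo P (joint_freq R N) ->
  0 < E /\ - (n%:R^-1 * ln E) <= primal P W Rt (joint_freq R N) + slack n.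
Proof.
move=> sN KV sl; have n0R : 0 < n%:R :> R by rewrite ltr0n.
have /andP[M1 M2] := M_bounds.
have [p1 p2] := poly_le_expR n0.
set B := expR 1 * n.+1%:R in p1 p2.
have B0 : 0 < B by rewrite mulr_gt0 ?expR_gt0 ?ltr0n.
have PB0 : 0 < B ^+ c * B ^+ #|X| by rewrite mulr_gt0// exprn_gt0.
set V := joint_freq R N in KV sl *; set u := L - _ - _ + _ in sl.
have small : 2 * (n.+1%:R ^+ c * B ^+ #|X| * expR (- (n%:R * u))) <= 1.
  rewrite mulrA [leRHS](_ : 1 = expR (n%:R * u) * expR (- (n%:R * u))); last first.
    by rewrite -expRD subrr expR0.
  apply: ler_wpM2r; first exact: expR_ge0.
  apply: (@le_trans _ _ (expR (n%:R * slack n))); last by rewrite ler_expR ler_pM2l.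
  apply: le_trans p1; rewrite ler_pM2l// ler_pM2r ?exprn_gt0//.
  rewrite lerXn2r ?nnegrE ?(ltW B0)// /B ler_peMl//.
  by rewrite -expR0 ler_expR.
have low := expected_L1_ge HW HPd n0 TP0 R0 M1 M2 FL sN KV small.
rewrite -/E -/B -/c -/V in low.
have h : expR (- (n%:R * (primal P W Rt V + slack n))) <= E.
  have -> : - (n%:R * (primal P W Rt V + slack n)) =
    - (n%:R * primal P W Rt V) + - (n%:R * slack n) by ring.
  rewrite expRD [X in _ * X <= _]expRN ler_pdivrMr ?expR_gt0//.
  have E0 : 0 <= E.
    by rewrite -(pmulr_lge0 _ PB0); apply: le_trans low; rewrite mulr_ge0 ?expR_ge0//;
      lra.
  apply: le_trans (ler_wpM2l E0 p2); rewrite mulrCA -ler_pdivrMl//.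
  by rewrite invf_div; exact: low.
have E0 : 0 < E by apply: lt_le_trans h; exact: expR_gt0.
split=> //.
have : - (n%:R * (primal P W Rt V + slack n)) <= ln E.
  by rewrite -[leLHS]expRK ler_ln ?posrE ?expR_gt0.
by move=> h2; rewrite lerNl ler_pdivlMl// mulrN.
Qed.

End Limit.

Local Open Scope classical_set_scope.
Local Open Scope ring_scope.

Theorem theorem2 (R : realType) (X Y : finType) (W : X -> Y -> R)
  (m : nat) (P : X -> R) (Rt : R) :
  is_channel W -> (0 < m)%N -> is_mtype m P ->
  (forall k : nat, exists x : (m * k.+1).-tuple X,
      x \in typeclass (m * k.+1) P /\
      exists y : (m * k.+1).-tuple Y, chanN W x y != outRY P W y) ->
  (mutinf P W < Rt%:E)%E ->
  exists L : R,
    (fun k : nat =>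
       - (((m * k.+1)%N)%:R^-1 *
          ln (expected_L1 (m * k.+1) (ncode Rt (m * k.+1)) P W))) @ \oo --> L
    /\ ((exists Q : X -> Y -> R, is_channel Q /\ primal_obj Rt P W Q = L%:E)
        /\ (forall Q : X -> Y -> R, is_channel Q -> (L%:E <= primal_obj Rt P W Q)%E))
    /\ ((exists l : R, 1 <= l <= 2 /\ dual_obj Rt P W l = L%:E)
        /\ (forall l : R, 1 <= l <= 2 -> (dual_obj Rt P W l <= L%:E)%E)).
Proof.
move=> HW m0 [HPd Pm] nondeg; rewrite (mutinf_fin HW HPd) lte_fin => IR.
have KJ := admissible_joint HW HPd.
have I0 := minfo_ge0 HPd KJ.
have R0 : 0 < Rt by exact: le_lt_trans IR.
have [V KV Vmin] := primal_min_exists Rt HW HPd.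
have D0 := div_joint_ge0 HW HPd KV.
have F0 : 0 <= primal P W Rt V.
  by rewrite addr_ge0// mulr_ge0 ?invr_ge0// le_max lexx.
set L := primal P W Rt V in Vmin F0 *.
exists L; split; last first.
  split; split.
  - exact: primal_attained.
  - move=> Q HQ; have [KQ|nKQ] := pselect (admissible P W (joint P Q)).
      rewrite primal_obj_fin// ?lee_fin; first exact: Vmin.
      by move=> a b; case: (HQ a).
    by rewrite primal_obj_infty// leey.
  - exact: dual_attained.
  - by move=> l l12; exact: dual_obj_le.
pose n_ k := (m * k.+1)%N.
have n0 k : (0 < n_ k)%N by rewrite muln_gt0 m0.
have kn k : (k < n_ k)%N by rewrite /n_ leq_pmull.
have TP0 k : (0 < #|typeclass (n_ k) P|)%N.
  by have [x [xP _]] := nondeg k; apply/card_gt0P; exists x.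
(* With zero information all codewords of the type class induce the same output law, which would be
   [outRY] itself, against non-degeneracy at the first length. *)
have IJ0 : 0 < minfo P (joint P W).
  rewrite lt_neqAle I0 andbT eq_sym; apply/eqP => IJ.
  have IJ0 : minfo P (joint P W) <= 0 by rewrite IJ.
  have WE := minfo_joint_le0 HW HPd IJ0.
  have chanE x y : x \in typeclass (n_ 0) P ->
      chanN W x y = \prod_i margY (joint P W) (tnth y i).
    move=> /typeclassP xP; apply: eq_bigr => i _; apply: WE.
    by rewrite -xP emp_gt0.
  have [x [xP [y /eqP]]] := nondeg 0%N; apply; rewrite -/(n_ 0%N) in x xP y *.
  rewrite /outRY (eq_bigr _ (fun x xP => chanE x y xP)) sumr_const chanE//.
  by rewrite -[X in _ = _ * X]mulr_natl mulKf// pnatr_eq0 -lt0n TP0.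
have [kk kkE] := choice Pm.
have naE k a : (kk a * k.+1)%N%:R = (n_ k)%:R * P a.
  by rewrite kkE /n_ !natrM; field; rewrite pnatr_eq0 -lt0n.
(* The type of [N] depends on [k], so only its frequencies are chosen as a sequence; [N] is
   recovered for each [k] when needed. *)
have /choice[V_ V_P] k : exists V' : X * Y -> R,
    exists N : {ffun X * Y -> 'I_(n_ k).+1},
    [/\ V' = joint_freq R N, (\sum_t N t = n_ k)%N, admissible P W (joint_freq R N) &
      forall t, `|joint_freq R N t - V t| <= #|Y|.+1%:R / (n_ k)%:R].
  have [N [N1 N2 N3]] := rounding HPd (n0 k) (naE k) KV.
  by exists (joint_freq R N); exists N.
have V_cvg t : V_ k t @[k --> \oo] --> V t.
  apply/cvgrPdist_le => e e0.
  have h : #|Y|.+1%:R * harmonic k @[k --> \oo] --> (0 : R).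
    rewrite -[X in _ --> X](mulr0 #|Y|.+1%:R); apply: cvgM; first exact: cvg_cst.
    exact: cvg_harmonic.
  have /cvgrPdist_le/(_ e e0) := h; apply: filterS => k.
  rewrite sub0r normrN ger0_norm; last by rewrite mulr_ge0 ?harmonic_ge0.
  apply: le_trans; rewrite distrC; have [N [-> _ _ Nb]] := V_P k.
  apply: (le_trans (Nb t)); rewrite ler_pM2l ?ltr0n//.
  by rewrite lef_pV2 ?posrE ?ltr0n// ler_nat.
have F_cvg : primal P W Rt (V_ k) @[k --> \oo] --> L by exact: primal_cvg.
have s_cvg : slack R X Y (n_ k) @[k --> \oo] --> 0 by exact: slack_cvg.
pose u k := L - Rt / 2 - div_joint P W (V_ k) + minfo P (V_ k).
have u_cvg : u k @[k --> \oo] --> L - Rt / 2 - div_joint P W V + minfo P V.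
  apply: cvgD; last exact: minfo_cvg.
  by apply: cvgB; [exact: cvg_cst|exact: div_joint_cvg].
(* If [minfo P V <= Rt] this is [minfo P V / 2], positive because [L < Rt / 2]; otherwise it is
   [minfo P V - Rt / 2], more than [Rt / 2]. *)
have u0 : 0 < L - Rt / 2 - div_joint P W V + minfo P V.
  have := minfo_ge0 HPd KV; have := Vmin _ KJ; have := primal_joint_lt HW HPd R0 IJ0.
  by rewrite /L /primal; case: (leP 0 (Rt - minfo P V)) => h; lra.
have su : \forall k \near \oo, slack R X Y (n_ k) <= u k.
  have su_cvg : u k - slack R X Y (n_ k) @[k --> \oo] -->
    L - Rt / 2 - div_joint P W V + minfo P V - 0 by apply: cvgB.
  rewrite subr0 in su_cvg; near=> k; rewrite -subr_ge0 ltW//; near: k.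
  exact: cvgr_gt su_cvg _ u0.
have lo_cvg : L - slack R X Y (n_ k) @[k --> \oo] --> L.
  by rewrite -[X in _ --> X]subr0; apply: cvgB => //; exact: cvg_cst.
have up_cvg : primal P W Rt (V_ k) + slack R X Y (n_ k) @[k --> \oo] --> L.
  by rewrite -[X in _ --> X]addr0; apply: cvgD.
apply: squeeze_cvgr lo_cvg up_cvg; near=> k.
have suk : slack R X Y (n_ k) <= u k by near: k.
have [N [VN sN KN _]] := V_P k; rewrite /u VN in suk *.
have Mb := @ncode_bounds R Rt (n_ k) (ltW R0).
have [E0 up] := rate_le HW HPd (ltW R0) Vmin (n0 k) (TP0 k) Mb sN KN suk.
by rewrite up andbT; exact: (rate_ge HW Vmin (n0 k) (TP0 k) Mb E0).
Unshelve. all: by end_near.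
Qed.
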